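(* Let $d, N$ be positive integers, let $P \in \mathcal M_N(\mathbb R)$ be a stochastic strongly connected matrix with positive diagonal entries, and let $\mathcal A = (A_1, \dotsc, A_N) \in \mathcal M_d(\mathbb R)^N$ be irreducible with $A_1, \dotsc, A_N$ invertible. Then, for every $s \in \{1,\dotsc,N\}$, $C(P, s)$ is irreducible. Moreover, $\rho_{\mathrm d}(\mathcal A) = \rho_{\mathrm p}(P, \mathcal A)$ if and only if there exists an invertible matrix $G \in \mathcal M_d(\mathbb R)$ such that, for every $i \in \{1,\dotsc,N\}$, $\rho_{\mathrm d}(\mathcal A)^{-1} G A_i G^{-1}$ is orthogonal.
   Context: $\mathcal M_n(\mathbb R)$ is the space of $n\times n$ real matrices; $\|\cdot\|$ is any norm on $\mathcal M_d(\mathbb R)$ induced by a norm on $\mathbb R^d$ (the quantities below do not depend on this choice). A family (tuple or set) of matrices in $\mathcal M_d(\mathbb R)$ is irreducible if the only subspaces of $\mathbb R^d$ invariant under all its matrices are $\{0\}$ and $\mathbb R^d$. A matrix $P = (p_{ij})_{1\le i,j\le N}$ with nonnegative entries is stochastic if $\sum_{j=1}^N p_{ij} = 1$ for every $i$, and strongly connected if it is not similar via a permutation to an upper block triangular matrix (equivalently, the directed graph on $\{1,\dotsc,N\}$ with an edge $i\to j$ whenever $p_{ij}>0$ is strongly connected). A row vector $\nu = (\nu_1,\dotsc,\nu_N)$ is an invariant probability for $P$ if $\nu_i \ge 0$ for all $i$, $\sum_i \nu_i = 1$ and $\nu = \nu P$. For $k\ge 1$, $(i_1,\dotsc,i_k)\in\{1,\dotsc,N\}^k$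 is a $P$-cycle with starting index $i_1$ if $p_{i_1 i_2} p_{i_2 i_3}\dotsm p_{i_{k-1} i_k} p_{i_k i_1} > 0$ (for $k=1$: $p_{i_1i_1}>0$). For $s\in\{1,\dotsc,N\}$, $$C(P,s) = \{A_{i_k}\dotsm A_{i_1} \mid (i_1,\dotsc,i_k) \text{ is a } P\text{-cycle and } i_1 = s\}.$$ The deterministic joint spectral radius is $$\rho_{\mathrm d}(\mathcal A) = \limsup_{n\to\infty} \max_{(i_1,\dotsc,i_n)\in\{1,\dotsc,N\}^n} \|A_{i_n}\dotsm A_{i_1}\|^{1/n}.$$ For an invariant probability $\nu$ for $P$, $$\rho_{\mathrm p}(\nu,P,\mathcal A) = \limsup_{n\to\infty} \sum_{(i_1,\dotsc,i_n)\in\{1,\dotsc,N\}^n} \nu_{i_1} p_{i_1 i_2}\dotsm p_{i_{n-1} i_n} \|A_{i_n}\dotsm A_{i_1}\|^{1/n},$$ and $\rho_{\mathrm p}(P,\mathcal A) = \sup_{\nu}\rho_{\mathrm p}(\nu,P,\mathcal A)$ over all invariant probabilities $\nu$ for $P$ (the invariant probability is unique when $P$ is strongly connected). *)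

(* Defs.v *)
From HB Require Import structures.
From mathcomp Require Import all_boot all_order all_algebra all_fingroup.
From mathcomp Require Import all_classical all_reals all_analysis.
Set Implicit Arguments.
Unset Strict Implicit.
Unset Printing Implicit Defensive.
Import Order.TTheory GRing.Theory Num.Theory.
Import numFieldNormedType.Exports.
Local Open Scope classical_set_scope.
Local Open Scope ring_scope.

(* Indices 1, ..., N are the ordinals ['I_N]; vectors of R^d are
   column vectors. *)

(* [nrm] is an arbitrary norm on R^d, independent of the topology and norm that
   the library puts on matrices. *)
Definition is_norm (R : realType) (d : nat) (nrm : 'cV[R]_d -> R) : Prop :=
  [/\ forall x, 0 <= nrm x,
      forall x, nrm x = 0 -> x = 0,
      forall (a : R) x, nrm (a *: x) = `|a| * nrm x
    & forall x y, nrm (x + y) <= nrm x + nrm y].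

(* The real [sup] is meaningful here: the set contains [nrm 0 = 0] and is
   bounded, as [d] is finite. *)
Definition opnorm (R : realType) (d : nat) (nrm : 'cV[R]_d -> R)
    (M : 'M[R]_d) : R :=
  sup [set nrm (M *m x) | x in [set x | nrm x <= 1]].

Definition irreducible_mxset (R : realType) (d : nat) (S : set 'M[R]_d) : Prop :=
  forall V : {vspace 'cV[R]_d},
    (forall M, S M -> forall x, x \in V -> M *m x \in V) ->
    V = 0%VS \/ V = fullv.

Definition stochastic (R : realType) (N : nat) (P : 'M[R]_N) : Prop :=
  (forall i j, 0 <= P i j) /\ (forall i, \sum_j P i j = 1).

(* Two nontrivial square diagonal blocks, of sizes [k] and [N - k]. *)
Definition block_upper_triangular (R : realType) (N : nat) (Q : 'M[R]_N) : Prop :=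
  exists k : nat, (0 < k < N)%N /\
    forall i j : 'I_N, (k <= i)%N -> (j < k)%N -> Q i j = 0.

Definition strongly_connected (R : realType) (N : nat) (P : 'M[R]_N) : Prop :=
  ~ exists s : 'S_N,
      block_upper_triangular (perm_mx s *m P *m invmx (perm_mx s)).

Definition invariant_probability (R : realType) (N : nat) (P : 'M[R]_N)
    (nu : 'rV[R]_N) : Prop :=
  [/\ forall i, 0 <= nu ord0 i, \sum_i nu ord0 i = 1 & nu = nu *m P].

(* [path_weight P i1 [:: i2; ...; ik]] is the product of the [p_{i_j i_(j+1)}]
   for [1 <= j < k]. *)
Fixpoint path_weight (R : realType) (N : nat) (P : 'M[R]_N) (i : 'I_N)
    (w : seq 'I_N) : R :=
  if w is j :: w' then P i j * path_weight P j w' else 1.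

(* The first letter acts first: [word_prod A [:: i1; ...; ik]] is the product
   [A_ik ... A_i1]. *)
Definition word_prod (R : realType) (d N : nat) (A : 'I_N -> 'M[R]_d)
    (w : seq 'I_N) : 'M[R]_d :=
  foldl (fun M i => A i *m M) 1%:M w.

Definition P_cycle (R : realType) (N : nat) (P : 'M[R]_N) (i : 'I_N)
    (w : seq 'I_N) : Prop :=
  0 < path_weight P i (rcons w i).

Definition cycle_products (R : realType) (d N : nat) (A : 'I_N -> 'M[R]_d)
    (P : 'M[R]_N) (s : 'I_N) : set 'M[R]_d :=
  [set word_prod A (s :: w) | w in [set w | P_cycle P s w]].

(* In both radii the [n]-th term of the sequence is the one for words of length
   [n.+1], which does not change the limsup; the sequences are bounded, so that
   the real-valued [limn_sup] is the usual limsup. The big maximum is over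
   nonnegative reals, so that starting from 0 is harmless. *)
Definition rho_d (R : realType) (d N : nat) (nrm : 'cV[R]_d -> R)
    (A : 'I_N -> 'M[R]_d) : R :=
  limn_sup (fun n : nat =>
    \big[Num.max/0]_(w : n.+1.-tuple 'I_N)
      opnorm nrm (word_prod A w) `^ (n.+1%:R^-1)).

Definition rho_p_nu (R : realType) (d N : nat) (nrm : 'cV[R]_d -> R)
    (nu : 'rV[R]_N) (P : 'M[R]_N) (A : 'I_N -> 'M[R]_d) : R :=
  limn_sup (fun n : nat =>
    \sum_(w : n.+1.-tuple 'I_N)
      nu ord0 (thead w) * path_weight P (thead w) (behead w) *
      opnorm nrm (word_prod A w) `^ (n.+1%:R^-1)).

Definition rho_p (R : realType) (d N : nat) (nrm : 'cV[R]_d -> R)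
    (P : 'M[R]_N) (A : 'I_N -> 'M[R]_d) : R :=
  sup [set rho_p_nu nrm nu P A | nu in [set nu | invariant_probability P nu]].

Definition orthogonal_mx (R : realType) (d : nat) (M : 'M[R]_d) : Prop :=
  M^T *m M = 1%:M.

(* Main.v *)
(* Cycle products. If [Z A_j W] and [Z A_j A_j W] are cycle products, a group
   containing them and [W] contains [A_j]. Walking along paths from [s], every
   group that contains the cycle products at [s] contains all [A_i]. Applied to
   the stabilizer of a subspace, this is the irreducibility of [C(P, s)].

   Equality of the radii. Put [r = rho_d] and [B_i = A_i / r]. By irreducibility
   the products of the [B_i] are bounded, so there is a norm [v] in which all
   [B_i] are contractions. Submultiplicativity, AM-GM over blocks of length [m]
   and stationarity give [rho_p <= r * E (v(B_w) ^ (1/m))], [w] a random word of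
   length [m]. If [rho_p = r], then [v(B_w) = 1] for every word [w] of positive
   probability: the cycle products at [s] form an irreducible semigroup of
   invertible matrices, bounded and bounded away from [0].

   Such a semigroup preserves a positive definite form. Choose finitely many
   generators [X]. A Cesaro limit gives a positive semidefinite [Q <> 0] equal to
   the mean of the [X^T Q X]; its kernel is invariant, so it is definite. Let
   [M0] maximize the Frobenius norm of [M^T Q M] on the closure of the semigroup.
   By strict convexity [M^T Q M] is the same matrix for all [M] in the orbit of
   [M0]. Linear recurrences extend this from powers of [X] to the inverse of
   [X], so by irreducibility the inverses are bounded and [M0] is invertible;
   cancelling [M0] in [M0^T X^T Q X M0 = M0^T Q M0] gives [X^T Q X = Q]. The first
   argument, applied to the isometry group of [Q], shows that every [B_i]
   preserves [Q], and [Q = G^T G] gives [G]. *)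

Require Import Defs.
From HB Require Import structures.
From mathcomp Require Import all_boot all_order all_algebra all_fingroup.
From mathcomp Require Import all_classical all_reals all_analysis.
From mathcomp Require Import ring lra.
Set Implicit Arguments.
Unset Strict Implicit.
Unset Printing Implicit Defensive.
Import Order.TTheory GRing.Theory Num.Theory.
Import numFieldNormedType.Exports.
Local Open Scope classical_set_scope.
Local Open Scope ring_scope.

(** * Topology of matrix spaces *)

Section MatrixTopology.
Variable R : realType.

Lemma mx_continuous (T : topologicalType) m n (f : T -> 'M[R]_(m, n)) :
  (forall i j, continuous (fun t => f t i j)) -> continuous f.
Proof.
move=> cf x A [P nP sPA].
apply: (@filterS _ _ _ [set y | forall i j, P i j (f y i j)]).
  by move=> y /= Hy; apply: sPA.
apply: filter_forall => i; apply: filter_forall => j.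
exact: cf (nP i j).
Qed.

Lemma sum_continuous (T : topologicalType) (V : normedModType R) (I : Type)
    (r : seq I) (P : pred I) (f : I -> T -> V) :
  (forall i, continuous (f i)) -> continuous (fun t => \sum_(i <- r | P i) f i t).
Proof.
move=> cf; elim: r => [|i r IH].
  under [X in continuous X]funext => x do rewrite big_nil.
  by move=> t; exact: cvg_cst.
under [X in continuous X]funext => x do rewrite big_cons.
by case: (P i) => // t; apply: cvgD; [exact: cf|exact: IH].
Qed.

Lemma mulmx_continuous (T : topologicalType) m n p (f : T -> 'M[R]_(m, n))
    (g : T -> 'M[R]_(n, p)) :
  continuous f -> continuous g -> continuous (fun t => f t *m g t).
Proof.
move=> cf cg; apply: mx_continuous => i j.
under [X in continuous X]funext => t do rewrite mxE.
move=> t; apply: sum_continuous => k {}t; apply: cvgM.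
  exact: (continuous_comp (cf t) (@coord_continuous _ _ _ i k _)).
exact: (continuous_comp (cg t) (@coord_continuous _ _ _ k j _)).
Qed.

Lemma trmx_continuous (T : topologicalType) m n (f : T -> 'M[R]_(m, n)) :
  continuous f -> continuous (fun t => (f t)^T).
Proof.
move=> cf; apply: mx_continuous => i j.
under [X in continuous X]funext => t do rewrite mxE.
by move=> t; exact: (continuous_comp (cf t) (@coord_continuous _ _ _ j i _)).
Qed.

Lemma mxtrace_continuous (T : topologicalType) n (f : T -> 'M[R]_n) :
  continuous f -> continuous (fun t => \tr (f t)).
Proof.
move=> cf t; apply: sum_continuous => k {}t.
exact: (continuous_comp (cf t) (@coord_continuous _ _ _ k k _)).
Qed.

Lemma closed_le_fun (T : topologicalType) (f g : T -> R) :
  continuous f -> continuous g -> closed [set t | f t <= g t].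
Proof.
move=> cf cg.
have -> : [set t | f t <= g t] = (fun t => g t - f t) @^-1` [set x | 0 <= x].
  by apply/seteqP; split => t /=; rewrite subr_ge0.
apply: closed_comp; last exact: closed_ge.
by move=> t _; apply: cvgB; [exact: cg|exact: cf].
Qed.

Lemma closed_forall (T : topologicalType) (I : Type) (F : I -> set T) :
  (forall i, closed (F i)) -> closed [set x | forall i, F i x].
Proof.
move=> cF; have -> : [set x | forall i, F i x] = \bigcap_i F i.
  by apply/seteqP; split=> x /= H i //; apply: H.
by apply: closed_bigI => i _; exact: cF.
Qed.

Lemma closure_min (T : topologicalType) (A F : set T) :
  closed F -> A `<=` F -> closure A `<=` F.
Proof.
move=> cF /closure_subset AF; apply: subset_trans AF _.
by rewrite -(closure_id F).1.
Qed.

Lemma closed_mx_eq (T : topologicalType) m n (f g : T -> 'M[R]_(m, n)) :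
  continuous f -> continuous g -> closed [set t | f t = g t].
Proof.
move=> cf cg.
have -> : [set t | f t = g t] = (fun t => f t - g t) @^-1` [set 0].
  by apply/seteqP; split => t /= /eqP; [rewrite -subr_eq0 => /eqP|rewrite subr_eq0 => /eqP].
apply: closed_comp; last exact/accessible_closed_set1/hausdorff_accessible/norm_hausdorff.
by move=> t _; apply: cvgB; [exact: cf|exact: cg].
Qed.

Lemma mx_norm_entry m n (M : 'M[R]_(m, n)) i j : `|M i j| <= `|M|.
Proof.
rewrite [leRHS]/Num.Def.normr /= mx_normrE.
exact: (@le_bigmax _ _ _ 0 (fun ij : 'I_m * 'I_n => `|M ij.1 ij.2|) (i, j)).
Qed.

Lemma mx_norm_le m n (M : 'M[R]_(m, n)) (c : R) :
  0 <= c -> (forall i j, `|M i j| <= c) -> `|M| <= c.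
Proof.
move=> c0 H; rewrite [leLHS]/Num.Def.normr /= mx_normrE; apply/bigmax_leP.
by split=> // -[i j] _ /=.
Qed.

Lemma mx_norm_trmx m n (M : 'M[R]_(m, n)) : `|M^T| = `|M|.
Proof.
apply/eqP; rewrite eq_le; apply/andP; split; apply: mx_norm_le => // i j.
  by rewrite mxE; exact: mx_norm_entry.
by have := mx_norm_entry M^T j i; rewrite mxE.
Qed.

Lemma mx_norm_mulmx m n p (M : 'M[R]_(m, n)) (N : 'M[R]_(n, p)) :
  `|M *m N| <= n%:R * `|M| * `|N|.
Proof.
apply: mx_norm_le => [|i j]; first by rewrite !mulr_ge0.
rewrite mxE (le_trans (ler_norm_sum _ _ _))//.
apply: (@le_trans _ _ (\sum_(k < n) `|M| * `|N|)).
  by apply: ler_sum => k _; rewrite normrM ler_pM// mx_norm_entry.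
by rewrite sumr_const card_ord -mulrA mulr_natl.
Qed.

(** Heine-Borel for row vectors, transported to matrices along [vec_mx]. *)
Lemma mx_compact m n (A : set 'M[R]_(m, n)) (c : R) :
  (forall M, A M -> `|M| <= c) -> closed A -> compact A.
Proof.
move=> bA cA.
have cv : continuous (@vec_mx R m n).
  apply: mx_continuous => i j.
  under [X in continuous X]funext => t do rewrite mxE.
  exact: coord_continuous.
have -> : A = @vec_mx R m n @` (@vec_mx R m n @^-1` A).
  apply/seteqP; split => [M AM|M [v Av <-]//].
  by exists (mxvec M) => //=; rewrite mxvecK.
apply: continuous_compact; first exact: continuous_subspaceT.
apply: bounded_closed_compact; last by apply: closed_comp => // t _; exact: cv.
exists c; split => [|x cx v Av]; first exact: num_real.
have cx' := ltW cx.
apply: le_trans cx'; apply: le_trans (bA _ Av); apply: mx_norm_le => // i k.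
rewrite ord1; case/mxvec_indexP: k => a b.
by have := mx_norm_entry (vec_mx v) a b; rewrite mxE.
Qed.

(** Takes the place of extracting a convergent subsequence: a cluster point inherits every closed
    property that holds eventually. *)
Lemma compact_seq_closed (T : topologicalType) (K : set T) (u : nat -> T) :
  compact K -> (forall n, K (u n)) ->
  exists2 x, K x & forall C : set T, closed C -> (\forall n \near \oo, C (u n)) -> C x.
Proof.
move=> cK Ku.
have uK : (u @ \oo) K by exists 0%N => // n _; exact: Ku.
have [x [Kx clx]] := cK (u @ \oo) _ uK.
exists x => // C cC uC; apply: cC => B nB.
by have [y [Cy By]] := clx C B uC nB; exists y.
Qed.

End MatrixTopology.

(** * Irreducible families and quadratic forms *)

Section IrreducibleSets.
Variables (R : realType) (d : nat).
Implicit Types (S G : set 'M[R]_d) (K M Z : 'M[R]_d).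

Lemma mulmx_cV_eq m n (K L : 'M[R]_(m, n)) :
  (forall x : 'cV[R]_n, K *m x = L *m x) -> K = L.
Proof.
move=> H; apply/matrixP => i j.
by have := H (delta_mx j 0); rewrite -!colE => /matrixP /(_ i 0); rewrite !mxE.
Qed.

Lemma unitmx_inj n (K : 'M[R]_n) :
  (forall x : 'cV[R]_n, K *m x = 0 -> x = 0) -> K \in unitmx.
Proof.
move=> H; rewrite -unitmx_tr -row_free_unit; apply: inj_row_free => v vK.
apply: trmx_inj; rewrite trmx0; apply: H.
by apply: trmx_inj; rewrite trmx_mul trmxK trmx0.
Qed.

(** A Schur-type dichotomy: the hypothesis makes the kernel of [K] an invariant subspace. The next
    lemma is its counterpart for the column space. *)
Lemma irreducible_ker S K : irreducible_mxset S ->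
  (forall M x, S M -> K *m x = 0 -> K *m (M *m x) = 0 :> 'cV_d) ->
  K = 0 \/ K \in unitmx.
Proof.
move=> irrS KS.
pose f := linfun (mulmx K : 'cV[R]_d -> 'cV[R]_d).
have kerE x : (x \in lker f) = (K *m x == 0) by rewrite memv_ker lfunE.
case: (irrS (lker f)) => [M SM x|V0|Vf].
- by rewrite !kerE => /eqP Kx; apply/eqP; exact: KS.
- right; apply: unitmx_inj => x /eqP.
  by rewrite -kerE V0 memv0 => /eqP.
- left; apply: mulmx_cV_eq => x; rewrite mul0mx.
  by apply/eqP; rewrite -kerE Vf memvf.
Qed.

Lemma irreducible_img S K : irreducible_mxset S ->
  (forall M, S M -> exists D : 'M[R]_d, M *m K = K *m D) ->
  K = 0 \/ K \in unitmx.
Proof.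
move=> irrS KS.
pose f := linfun (mulmx K : 'cV[R]_d -> 'cV[R]_d).
have fE x : f x = K *m x by rewrite lfunE.
case: (irrS (limg f)) => [M SM x|V0|Vf].
- move=> /memv_imgP[y _ ->]; have [D MK] := KS M SM.
  by rewrite fE mulmxA MK -mulmxA -fE memv_img// memvf.
- left; apply: mulmx_cV_eq => x; rewrite mul0mx -fE; apply/eqP.
  by rewrite -memv0 -V0 memv_img// memvf.
- right; have surj j : exists y : 'cV[R]_d, K *m y = delta_mx j 0.
    have : (delta_mx j 0 : 'cV[R]_d) \in limg f by rewrite Vf memvf.
    by move=> /memv_imgP[y _ ->]; exists y; rewrite fE.
  have [y Hy] := choice surj.
  have /mulmx1_unit[] // : K *m (\matrix_(i, j) y j i 0) = 1%:M.
  apply/matrixP => i j; have /matrixP/(_ i 0) := Hy j; rewrite !mxE.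
  by rewrite eqxx andbT => <-; apply: eq_bigr => k _; rewrite !mxE.
Qed.

(* An element of maximal rank has an invariant column space. *)
Lemma irreducible_ideal S G : irreducible_mxset S ->
  (forall Y Z, G Y -> G Z -> G (Y + Z)) ->
  (forall Z W, G Z -> G (Z *m W)) ->
  (forall M Z, S M -> G Z -> G (M *m Z)) ->
  forall Z, G Z -> Z <> 0 -> G 1%:M.
Proof.
move=> irrS GD Gr Gl Z0 GZ0 Z0neq0.
pose p n := `[< exists Z, G Z /\ \rank Z = n >].
have exp : exists n, p n by exists (\rank Z0); apply/asboolP; exists Z0.
have ubp n : p n -> (n <= d)%N by move=> /asboolP[Z [_ <-]]; exact: rank_leq_row.
case: (ex_maxnP exp ubp) => r /asboolP[Z [GZ rZ]] maxr.
have [||Zu] := @irreducible_img S Z irrS.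
(* Matrix spaces are row spaces, hence the transposes. [U] spans the columns of [Z] and [M *m Z]
   together, and [U^T] is still in [G]. Maximality of the rank then puts the columns of [M *m Z] in
   the span of those of [Z]. *)
- move=> M SM; pose U : 'M[R]_d := (Z^T + (M *m Z)^T)%MS.
  have /sub_addsmxP[u Uu] : (U <= Z^T + (M *m Z)^T)%MS by exact: submx_refl.
  have GU : G U^T.
    rewrite Uu raddfD /= !trmx_mul !trmxK; apply: GD; first exact: Gr.
    by apply: Gr; exact: Gl.
  have rU : (\rank U <= r)%N.
    by apply: maxr; apply/asboolP; exists U^T; rewrite mxrank_tr.
  have ZU : (Z^T <= U)%MS by exact: addsmxSl.
  have UZ : (U <= Z^T)%MS.
    by rewrite -(geq_leqif (mxrank_leqif_sup ZU)) mxrank_tr rZ.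
  have /submxP[D HD] : ((M *m Z)^T <= Z^T)%MS.
    by apply: submx_trans UZ; exact: addsmxSr.
  exists D^T; apply: trmx_inj.
  by rewrite HD trmx_mul trmxK.
- move=> Z_eq0; exfalso; apply: Z0neq0; apply/eqP; rewrite -mxrank_eq0 -leqn0.
  have <- : \rank Z = 0%N by rewrite Z_eq0 mxrank0.
  by rewrite rZ; apply: maxr; apply/asboolP; exists Z0.
- by rewrite -(mulmxV Zu); exact: Gr.
Qed.

End IrreducibleSets.

Section QuadraticForms.
Variable R : realType.

Definition qform n (Q : 'M[R]_n) (x : 'cV[R]_n) : R := (x^T *m Q *m x) 0 0.

Definition pos_def n (Q : 'M[R]_n) :=
  Q^T = Q /\ forall x, x <> 0 -> 0 < qform Q x.

(** The trace is the squared Frobenius norm, the sum of the squares of all entries, while [|M|] is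
    the largest modulus of an entry. *)
Lemma frob_ge m n (M : 'M[R]_(m, n)) : `|M| ^+ 2 <= \tr (M^T *m M).
Proof.
have trE : \tr (M^T *m M) = \sum_j \sum_i (M i j) ^+ 2.
  by apply: eq_bigr => j _; rewrite mxE; apply: eq_bigr => i _; rewrite mxE expr2.
have tr0 : 0 <= \tr (M^T *m M).
  by rewrite trE; apply: sumr_ge0 => j _; apply: sumr_ge0 => i _; exact: sqr_ge0.
rewrite -[leRHS]sqr_sqrtr// lerXn2r ?nnegrE//.
apply: mx_norm_le => // i j.
rewrite -sqrtr_sqr ler_sqrt// trE (bigD1 j)//= (bigD1 i)//= -addrA lerDl.
apply: addr_ge0; apply: sumr_ge0 => k _; first exact: sqr_ge0.
by apply: sumr_ge0 => l _; exact: sqr_ge0.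
Qed.

Lemma frob_ge0 m n (M : 'M[R]_(m, n)) : 0 <= \tr (M^T *m M).
Proof. by apply: le_trans (frob_ge M); exact: sqr_ge0. Qed.

Lemma frob_le0 m n (M : 'M[R]_(m, n)) : \tr (M^T *m M) <= 0 -> M = 0.
Proof.
move=> H; have := le_trans (frob_ge M) H.
by rewrite le_eqVlt ltNge sqr_ge0 orbF sqrf_eq0 normr_eq0 => /eqP.
Qed.

Lemma qform_conj n (Q X : 'M[R]_n) x : qform (X^T *m Q *m X) x = qform Q (X *m x).
Proof. by rewrite /qform trmx_mul !mulmxA. Qed.

(** Move from [x] in the direction [z = Q x]: the form at [x + t z] is [t (t q(z) + 2 |z|^2)], which
    is negative for small [t < 0] unless [z = 0]. *)
Lemma psd_ker n (Q : 'M[R]_n) (x : 'cV[R]_n) : Q^T = Q ->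
  (forall y, 0 <= qform Q y) -> qform Q x = 0 -> Q *m x = 0.
Proof.
move=> symQ posQ qx.
set z := Q *m x.
have E t : qform Q (x + t *: z) = t * (t * qform Q z + (2 * \tr (z^T *m z))).
  rewrite /qform; rewrite (_ : (_ + _)^T = x^T + t *: z^T); last first.
    by rewrite raddfD /= linearZ.
  rewrite !mulmxDl !mulmxDr -!scalemxAl -!scalemxAr.
  have xQ : x^T *m Q = z^T by rewrite /z trmx_mul symQ.
  have e1 : (x^T *m Q *m x) 0 0 = 0 by exact: qx.
  have e2 : (z^T *m Q *m x) = z^T *m z by rewrite -mulmxA.
  have -> : \tr (z^T *m z) = (z^T *m z) 0 0 by rewrite /mxtrace big_ord1.
  rewrite e2 xQ !mxE; move: e1; rewrite xQ !mxE => ->; ring.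
apply: frob_le0; set b := \tr _ in E *; have := posQ z; set c := qform Q z in E *.
move=> c0; have b0 : 0 <= b by exact: frob_ge0.
rewrite leNgt; apply/negP => bpos.
(* With [t = - b / (c + 1)] the second factor is [b (2 - c / (c + 1))], which is positive. *)
have := posQ (x + (- (b / (c + 1))) *: z); rewrite E.
rewrite nmulr_rge0; last by rewrite oppr_lt0 divr_gt0// ltr_wpDl.
rewrite leNgt => /negP; apply.
rewrite mulNr addrC subr_gt0.
rewrite mulrAC ltr_pdivrMr; last by rewrite ltr_wpDl.
by nra.
Qed.

(** Cholesky factorization by induction on the size; the recursive call is on the Schur complement
    of the upper left entry. *)
Lemma pos_def_factor n (Q : 'M[R]_n) : pos_def Q ->
  exists2 G : 'M[R]_n, G \in unitmx & Q = G^T *m G.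
Proof.
elim: n Q => [|n IH] Q [symQ posQ].
  by exists 1%:M; [exact: unitmx1|apply/matrixP => -[]].
pose Q' : 'M[R]_(1 + n) := Q; have symQ' : Q'^T = Q' by exact: symQ.
pose a := ulsubmx Q' 0 0; pose b := ursubmx Q'; pose D := drsubmx Q'.
have QE : Q' = block_mx a%:M b b^T D.
  rewrite -[LHS]submxK; congr block_mx; first by rewrite [LHS]mx11_scalar.
  by rewrite /b trmx_ursub symQ'.
have qE (x : 'cV_(1 + n)) : qform Q x = (x^T *m Q' *m x) 0 0 by [].
have apos : 0 < a.
  have := posQ (col_mx 1%:M 0 : 'cV_(1 + n)).
  rewrite qE QE tr_col_mx mul_row_block mul_row_col.
  rewrite !trmx1 !trmx0 !mul0mx !mulmx0 !addr0 mul1mx mulmx1 mxE eqxx mulr1n.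
  apply => /(congr1 (@usubmx _ 1 n 1)); rewrite col_mxKu => /matrixP/(_ 0 0).
  by rewrite !mxE eqxx => /eqP; rewrite oner_eq0.
have [r ar] : exists r, a *: r = b.
  by exists (a^-1 *: b); rewrite scalerA divff ?gt_eqF// scale1r.
have arT : a *: r^T = b^T by rewrite -linearZ /= ar.
have [|G' G'u G'E] := IH (D - b^T *m r).
  split.
    rewrite raddfB /= trmx_mul trmxK -arT -[in LHS]ar -scalemxAr -scalemxAl.
    by rewrite /D trmx_drsub symQ'.
  (* The first coordinate [- r y] completes the square, so the value of [Q] at this vector is that
     of the Schur complement at [y]. *)
  move=> y y0; have := posQ (col_mx (- (r *m y)) y : 'cV_(1 + n)).
  have -> : qform Q (col_mx (- (r *m y)) y : 'cV_(1 + n)) =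
            qform (D - b^T *m r) y.
    rewrite qE QE /qform tr_col_mx mul_row_block mul_row_col.
    rewrite [(- _)^T]raddfN /= trmx_mul !mulNmx mul_mx_scalar.
    have -> : - (a *: (y^T *m r^T)) + y^T *m b^T = 0.
      by rewrite scalemxAr arT addNr.
    rewrite mul0mx add0r; congr ((_ *m _) _ _).
    by rewrite mulmxBr addrC -arT -[in LHS]ar -!scalemxAl -!scalemxAr mulmxA.
  apply => /(congr1 (@dsubmx _ 1 n 1)); rewrite col_mxKd => H; apply: y0.
  by rewrite H; apply/matrixP => i j; rewrite !mxE.
pose F : 'M[R]_(1 + n) := block_mx (Num.sqrt a)%:M (Num.sqrt a *: r) 0 G'.
have Fu : F \in unitmx.
  rewrite /F unitmxE det_ublock det_scalar1 unitrM -unitmxE G'u andbT unitfE.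
  by rewrite gt_eqF// sqrtr_gt0.
suff QF : Q' = F^T *m F by exists F.
rewrite QE /F tr_block_mx mulmx_block !trmx0 !mul0mx !mulmx0 !addr0.
rewrite tr_scalar_mx -scalar_mxM -G'E mul_scalar_mx mul_mx_scalar linearZ /=.
rewrite ![(Num.sqrt a *: r)^T]linearZ /= -!scalemxAl -!scalemxAr !scalerA -expr2 sqr_sqrtr ?ltW//.
by rewrite ar arT scalemxAl arT addrC subrK.
Qed.

End QuadraticForms.

(** * Fixed points and recurrences *)

Section Averages.
Variables (R : realType) (V : lmodType R).

Definition mean (l : seq V) : V := (size l)%:R^-1 *: \sum_(v <- l) v.

(** A convex combination of the head and the mean of the tail, which is the form needed for the
    induction in [mean_in]. *)
Lemma mean_cons v (l : seq V) : mean (v :: l) =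
  (size l).+1%:R^-1 *: v + (1 - (size l).+1%:R^-1) *: mean l.
Proof.
rewrite /mean big_cons scalerDr; congr (_ + _).
case: l => [|w l]; first by rewrite !big_nil !scaler0.
have n0 : (size (w :: l)).+1%:R != 0 :> R by rewrite pnatr_eq0.
rewrite scalerA; congr (_ *: _) => /=.
rewrite /= -[(size l).+2%:R]natr1 in n0 *.
have n1 : (size l).+1%:R != 0 :> R by rewrite pnatr_eq0.
by move: (_.+1%:R) n0 n1 => a a1 a0; field; rewrite a0 a1.
Qed.

Lemma mean_in (D : set V) (l : seq V) :
  (forall u v (t : R), D u -> D v -> 0 <= t <= 1 -> D (t *: u + (1 - t) *: v)) ->
  l <> [::] -> (forall v, v \in l -> D v) -> D (mean l).
Proof.
move=> Dconv; elim: l => // v l IH _ Dl; rewrite mean_cons.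
have Dv : D v by apply: Dl; rewrite inE eqxx.
case: l IH Dl => [|w l] IH Dl.
  by rewrite /= invr1 subrr scale0r addr0 scale1r.
apply: Dconv => //; last by rewrite invr_ge0 ler0n invf_le1 ?ltr0n// ler1n.
by apply: IH => // u ul; apply: Dl; rewrite inE ul orbT.
Qed.

End Averages.

Section FixedPoint.
Variables (R : realType) (m n : nat).
Notation V := 'M[R]_(m, n).

(** Markov-Kakutani for one map. The mean of the first [k + 1] iterates is moved by [T] by a
    telescoping sum divided by [k + 1], hence by at most [2 C / (k + 1)]; a cluster point of these
    means is fixed. *)
Lemma compact_convex_fixpoint (D : set V) (T : {linear V -> V}) Q0 :
  continuous T -> compact D -> D Q0 ->
  (forall u v (t : R), D u -> D v -> 0 <= t <= 1 -> D (t *: u + (1 - t) *: v)) ->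
  (forall Q, D Q -> D (T Q)) -> exists2 Q, D Q & T Q = Q.
Proof.
move=> cT cD D0 convD TD.
have DT k : D (iter k T Q0) by elim: k => //= k IH; exact: TD.
pose l k := mkseq (fun j => iter j T Q0) k.+1.
have Dl k : D (mean (l k)).
  apply: mean_in => //.
  by move=> v /mapP[j _ ->].
have [C HC] : exists C, forall Q, D Q -> `|Q| <= C.
  have [C [_ HC]] := compact_bounded cD.
  by exists (C + 1) => Q DQ; have /HC/(_ Q DQ) : C < C + 1 by rewrite ltrDl.
have C0 : 0 <= C by exact: le_trans (HC _ D0).
have diff k : `|T (mean (l k)) - mean (l k)| <= 2 * C / k.+1%:R.
  rewrite /mean size_mkseq linearZ /= -scalerBr normrZ.
  rewrite ger0_norm ?invr_ge0 ?ler0n// mulrC ler_wpM2r ?invr_ge0 ?ler0n//.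
  have -> : T (\sum_(v <- l k) v) - \sum_(v <- l k) v = iter k.+1 T Q0 - Q0.
    rewrite linear_sum /= /l /mkseq !big_map -/(index_iota 0 k.+1) -sumrB.
    by rewrite (telescope_sumr (fun j => iter j T Q0)).
  rewrite (le_trans (ler_normB _ _))// mulr_natl mulr2n lerD//; exact: HC.
have [Q DQ HQ] := compact_seq_closed cD Dl.
exists Q => //; apply/eqP; rewrite -subr_eq0 -normr_eq0 eq_le normr_ge0 andbT.
apply/ler_addgt0Pr => e e0; rewrite add0r.
pose F : set V := [set Q | `|T Q - Q| <= e].
apply: (HQ F).
  apply: closed_le_fun; last exact: cst_continuous.
  move=> x; apply: (@continuous_comp _ _ _ (fun Q => T Q - Q) Num.norm).
    exact: continuousB (cT x) (@cvg_id _ _).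
  exact: norm_continuous.
near=> k; rewrite /F /= (le_trans (diff k))// ler_pdivrMr ?ltr0n//.
rewrite [e * _]mulrC -ler_pdivrMr// ltW//.
near: k; exists (Num.truncn (2 * C / e)) => // k /= hk.
apply: lt_le_trans (truncnS_gt _) _.
by rewrite ler_nat ltnS.
Unshelve. all: by end_near.
Qed.

End FixedPoint.

Section Recurrence.
Variable R : realType.

(* By Cayley-Hamilton, [invmx Y] is a polynomial in [Y]. *)
Lemma constant_orbit_inv m q p (Y : 'M[R]_m) (r : 'M[R]_(q, m)) (v : 'M[R]_(m, p)) k :
  Y \in unitmx -> (forall n, iter n (mulmxr Y) r *m v = k) ->
  r *m invmx Y *m v = k.
Proof.
case: m Y r v => [|m] Y r v Yu H.
  by rewrite -(H 0%N) (flatmx0 v) !mulmx0.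
(* On this orbit every polynomial in [Y] acts as its value at 1. *)
have E (f : {poly R}) n : iter n (mulmxr Y) r *m horner_mx Y f *m v = f.[1] *: k.
  elim/poly_ind: f n => [|f c IH] n.
    by rewrite rmorph0 mulmx0 mul0mx horner0 scale0r.
  rewrite rmorphD rmorphM /= horner_mx_X horner_mx_C !hornerE.
  rewrite mulmxDr mulmxDl mul_mx_scalar -scalemxAl H scalerDl; congr (_ + _).
  rewrite (_ : horner_mx Y f * Y = Y *m horner_mx Y f); last first.
    exact: (comm_horner_mx f (erefl : comm_mx Y Y)).
  by rewrite mulmxA; exact: (IH n.+1).
(* Writing the characteristic polynomial as [f X + c] with [c] equal to the determinant up to sign,
   Cayley-Hamilton gives [c Y^-1 = - f(Y)], and [E] turns it into [(f(1) + c) k = 0]. Together these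
   give the claim after division by [c]. *)
have [f [c fE]] : exists f c, char_poly Y = f * 'X + c%:P.
  by elim/poly_ind: (char_poly Y) => [|f c _]; [exists 0, 0; rewrite mul0r addr0|exists f, c].
have c0 : c != 0.
  have := char_poly_det Y; rewrite fE coefD coefC /= coefMX /= add0r => ->.
  by rewrite mulf_neq0// ?signr_eq0// -unitfE -unitmxE.
have := Cayley_Hamilton Y; rewrite fE => CH.
have := congr1 (fun M => M *m invmx Y) CH.
rewrite rmorphD rmorphM /= horner_mx_X horner_mx_C mul0mx mulmxDl.
rewrite -[_ * Y]/(_ *m Y) mulmxK// mul_scalar_mx => /eqP.
rewrite addrC addr_eq0 => /eqP cY.
have := E (f * 'X + c%:P) 0%N; rewrite CH mulmx0 mul0mx !hornerE => fk.
apply: (scalerI c0); rewrite scalemxAl scalemxAr cY mulmxN mulNmx (E f 0%N).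
by apply/eqP; rewrite eq_sym -addr_eq0 -scalerDl addrC -fk.
Qed.

End Recurrence.

(** * Invariant quadratic forms of bounded semigroups *)

Section BoundedSemigroups.
Variables (R : realType) (d : nat).
Implicit Types (S : set 'M[R]_d) (L : seq 'M[R]_d) (Q X M : 'M[R]_d).

Inductive gen S : set 'M[R]_d :=
| gen1 : gen S 1%:M
| genM X M of S X & gen S M : gen S (X *m M).

Lemma gen_mul S M N : gen S M -> gen S N -> gen S (M *m N).
Proof.
move=> gM gN; elim: gM => [|X M' SX _ IH]; first by rewrite mul1mx.
by rewrite -mulmxA; apply: genM.
Qed.

Lemma gen_unit S M : (forall X, S X -> X \in unitmx) -> gen S M -> M \in unitmx.
Proof.
move=> Su; elim=> [|X M' SX _ IH]; first exact: unitmx1.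
by rewrite unitmx_mul Su.
Qed.

Lemma pullback_continuous (T : topologicalType) m n (f : T -> 'M[R]_(m, n))
    (g : T -> 'M[R]_m) :
  continuous f -> continuous g ->
  continuous (fun t => (f t)^T *m g t *m f t).
Proof.
move=> cf cg; apply: (mulmx_continuous _ cf).
exact: mulmx_continuous (trmx_continuous cf) cg.
Qed.

(** The form [Q] composed with the linear map [M]; it is contravariant in [M]. *)
Definition pullback m n (M : 'M[R]_(m, n)) (Q : 'M[R]_m) : 'M[R]_n := M^T *m Q *m M.

Lemma pullback_mul m n p (Q : 'M[R]_m) (X : 'M[R]_(m, n)) (M : 'M[R]_(n, p)) :
  pullback (X *m M) Q = pullback M (pullback X Q).
Proof. by rewrite /pullback trmx_mul !mulmxA. Qed.

Lemma pullback_is_linear m n (M : 'M[R]_(m, n)) : linear (pullback M).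
Proof.
by move=> a Q Q'; rewrite /pullback mulmxDr mulmxDl -scalemxAr -scalemxAl.
Qed.
HB.instance Definition _ m n (M : 'M[R]_(m, n)) :=
  GRing.isLinear.Build _ _ _ _ (pullback M) (pullback_is_linear M).

Definition transfer L Q := mean [seq pullback X Q | X <- L].

Lemma transfer_is_linear L : linear (transfer L).
Proof.
move=> a Q Q'; rewrite /transfer /mean !size_map !big_map.
rewrite scalerA mulrC -scalerA -scalerDr; congr (_ *: _).
rewrite scaler_sumr -big_split /=.
by apply: eq_bigr => X _; exact: pullback_is_linear.
Qed.
HB.instance Definition _ L :=
  GRing.isLinear.Build _ _ _ _ (transfer L) (transfer_is_linear L).

(** The fixed point theorem is applied to [transfer L] on a compact convex set containing the
    identity. The bounds in [D3] and [D4] are imposed along the whole semigroup, which makes them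
    stable under [transfer L]; [D3] keeps the fixed point away from 0. *)
Lemma invariant_cesaro_form L (C c : R) : L <> [::] ->
  (forall M, gen [set` L] M -> `|M| <= C) -> 0 < c ->
  (forall M, gen [set` L] M -> c <= `|M|) ->
  exists Q, [/\ Q^T = Q, forall x, 0 <= qform Q x, 0 < \tr Q & transfer L Q = Q].
Proof.
move=> L0 ubL c0 lbL; set S := gen [set` L].
have cconst (V : topologicalType) (W : topologicalType) (a : W) :
  continuous (fun _ : V => a) by exact: cst_continuous.
have cid : continuous (fun Q : 'M[R]_d => Q) by move=> x; exact: cvg_id.
pose D1 : set 'M[R]_d := [set Q | Q^T = Q].
pose D2 : set 'M[R]_d := [set Q | forall x, 0 <= qform Q x].
pose D3 : set 'M[R]_d := [set Q | forall M, S M -> c ^+ 2 <= \tr (pullback M Q)].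
pose D4 : set 'M[R]_d := [set Q | forall M, S M -> `|pullback M Q| <= d%:R * C * C].
pose D : set 'M[R]_d := D1 `&` D2 `&` D3 `&` D4.
have cpull (M : 'M[R]_d) : continuous (fun Q => pullback M Q).
  exact: (pullback_continuous (cconst _ _ M) cid).
have clD : closed D.
  apply: closedI; first apply: closedI; first apply: closedI.
  - by apply: closed_mx_eq => //; exact: trmx_continuous.
  - apply: closed_forall => x; apply: closed_le_fun; first exact: cconst.
    have cq : continuous (fun t : 'M[R]_d => x^T *m t *m x).
      exact: mulmx_continuous (mulmx_continuous (cconst _ _ _) cid) (cconst _ _ _).
    by move=> t; exact: (continuous_comp (cq t) (@coord_continuous _ _ _ 0 0 _)).
  - apply: closed_forall => M; apply: closed_forall => _.
    exact: closed_le_fun (cconst _ _ _) (mxtrace_continuous (cpull M)).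
  - apply: closed_forall => M; apply: closed_forall => _.
    apply: closed_le_fun (cconst _ _ _) => t; exact: (continuous_comp (cpull M t) (@norm_continuous _ _ _)).
have cD : compact D.
  apply: (@mx_compact _ _ _ D (d%:R * C * C)) => // Q [_ /(_ _ (gen1 _))].
  by rewrite /pullback trmx1 mul1mx mulmx1.
have convD u v (t : R) : D u -> D v -> 0 <= t <= 1 -> D (t *: u + (1 - t) *: v).
  move=> [[[u1 u2] u3] u4] [[[v1 v2] v3] v4] /andP[t0 t1].
  have t1' : 0 <= 1 - t by rewrite subr_ge0.
  split; first split; first split.
  - by rewrite /D1 /= raddfD /= !linearZ /= u1 v1.
  - move=> x; rewrite /qform mulmxDr mulmxDl -!scalemxAr -!scalemxAl !mxE.
    apply: addr_ge0; apply: mulr_ge0 => //; first by have := u2 x; rewrite /qform !mxE.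
    by have := v2 x; rewrite /qform !mxE.
  - move=> M SM; rewrite linearD !linearZ /= mxtraceD !mxtraceZ.
    have -> : c ^+ 2 = t * c ^+ 2 + (1 - t) * c ^+ 2 by ring.
    by apply: lerD; apply: ler_wpM2l => //; [exact: u3|exact: v3].
  - move=> M SM; rewrite linearD !linearZ /=.
    rewrite (le_trans (ler_normD _ _))// !normrZ !ger0_norm//.
    have -> : d%:R * C * C = t * (d%:R * C * C) + (1 - t) * (d%:R * C * C) by ring.
    by apply: lerD; apply: ler_wpM2l => //; [exact: u4|exact: v4].
have D1M : D 1%:M.
  split; first split; first split.
  - by rewrite /D1 /= trmx1.
  - move=> x; rewrite /qform mulmx1.
    by have := frob_ge0 x; rewrite /mxtrace big_ord1.
  - move=> M SM; rewrite /pullback mulmx1; apply: le_trans (frob_ge M).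
    by rewrite ler_sqr ?nnegrE ?(ltW c0) ?normr_ge0 ?lbL.
  - move=> M SM; rewrite /pullback mulmx1 (le_trans (mx_norm_mulmx _ _))//.
    have := ubL _ SM; rewrite mx_norm_trmx => H.
    by rewrite ler_pM ?mulr_ge0// ler_wpM2l.
have TD Q : D Q -> D (transfer L Q).
  move=> [[[q1 q2] q3] q4]; apply: mean_in => //; first by case: (L) L0.
  move=> _ /mapP[X XL ->].
  have SX M : S M -> S (X *m M) by move=> SM; apply: genM.
  split; first split; first split.
  - by rewrite /D1 /= /pullback !trmx_mul trmxK q1 mulmxA.
  - by move=> x; rewrite /pullback qform_conj.
  - by move=> M /SX SM; rewrite -pullback_mul; exact: q3.
  - by move=> M /SX SM; rewrite -pullback_mul; exact: q4.
have cT : continuous (transfer L).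
  have -> : (transfer L : 'M[R]_d -> 'M[R]_d) =
      (fun Q => (size L)%:R^-1 *: \sum_(X <- L) pullback X Q).
    by apply/funext => Z; rewrite /transfer /mean size_map big_map.
  have cs : continuous (fun Q => \sum_(X <- L) pullback X Q).
    by apply: sum_continuous => X; exact: cpull.
  move=> Q; exact: (continuousZ (@cst_continuous _ _ _ _) (cs Q)).
have [Q [[[Q1 Q2] Q3] Q4] TQ] := compact_convex_fixpoint cT cD D1M convD TD.
exists Q; split => //.
have := Q3 _ (gen1 _); rewrite /pullback trmx1 mul1mx mulmx1.
by apply: lt_le_trans; rewrite exprn_gt0.
Qed.

End BoundedSemigroups.

Section InvariantForm.
Variables (R : realType) (d : nat).
Implicit Types (L : seq 'M[R]_d) (Q X M : 'M[R]_d).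

Lemma qform_transfer L Q x :
  qform (transfer L Q) x = (size L)%:R^-1 * \sum_(X <- L) qform Q (X *m x).
Proof.
rewrite /transfer /mean size_map big_map /qform -scalemxAr -scalemxAl mxE.
rewrite mulmx_sumr mulmx_suml summxE; congr (_ * _).
by apply: eq_bigr => X _; rewrite /pullback trmx_mul !mulmxA.
Qed.

(** The value of [Q] at [x] is the mean of its nonnegative values at the [X x]; if it vanishes, so
    do all of them. Hence the kernel is invariant, and the positive trace excludes [Q = 0]. *)
Lemma transfer_pos_def L Q : L <> [::] -> irreducible_mxset [set` L] ->
  Q^T = Q -> (forall x, 0 <= qform Q x) -> 0 < \tr Q -> transfer L Q = Q ->
  pos_def Q.
Proof.
move=> L0 irrL symQ posQ trQ TQ.
have [|Q0|Qu] := @irreducible_ker _ _ [set` L] Q irrL.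
- move=> X x XL Qx; apply: psd_ker => //.
  have : qform Q x = 0 by rewrite /qform -mulmxA Qx mulmx0 mxE.
  rewrite -{1}TQ qform_transfer => /eqP; rewrite mulf_eq0 invr_eq0 pnatr_eq0.
  rewrite size_eq0; move/eqP/negPf: L0 => -> /=.
  by rewrite psumr_eq0// => /allP /(_ X XL) /= /eqP.
- by move: trQ; rewrite Q0 mxtrace0 ltxx.
- split=> // x x0; rewrite lt_neqAle posQ andbT; apply/negP => /eqP q0.
  have := congr1 (mulmx (invmx Q)) (psd_ker symQ posQ (esym q0)).
  by rewrite mulKmx// mulmx0.
Qed.

Lemma frob_sub m n (A B : 'M[R]_(m, n)) : \tr ((A - B)^T *m (A - B)) =
  \tr (A^T *m A) - 2 * \tr (B^T *m A) + \tr (B^T *m B).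
Proof.
have trC : \tr (A^T *m B) = \tr (B^T *m A) by rewrite -mxtrace_tr trmx_mul trmxK.
rewrite [(A - B)^T]raddfB /= mulmxBl !mulmxBr !raddfB /= trC.
ring.
Qed.

(** A variance argument: the sum of the [|F i - P|^2] is the sum of the [|F i|^2] minus [size s]
    times [|P|^2], in Frobenius norm, so it is at most 0. *)
Lemma mean_extremal (I : eqType) (s : seq I) m n (F : I -> 'M[R]_(m, n)) :
  let P := mean [seq F i | i <- s] in
  (forall i, i \in s -> \tr ((F i)^T *m F i) <= \tr (P^T *m P)) ->
  forall i, i \in s -> F i = P.
Proof.
move=> P H i si.
have s0 : (size s)%:R != 0 :> R.
  by rewrite pnatr_eq0 size_eq0; case: (s) si.
have sumF : \sum_(i <- s) F i = (size s)%:R *: P.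
  by rewrite /P /mean size_map big_map scalerA divff// scale1r.
have : \sum_(i <- s) \tr ((F i - P)^T *m (F i - P)) <= 0.
  under eq_bigr => j _ do rewrite frob_sub.
  have cross : \sum_(i <- s) \tr (P^T *m F i) = (size s)%:R * \tr (P^T *m P).
    by rewrite -raddf_sum /= -mulmx_sumr sumF -scalemxAr mxtraceZ.
  rewrite !big_split /= sumrN -mulr_sumr cross.
  rewrite big_const_seq count_predT iter_addr_0 -mulr_natl.
  have : \sum_(i <- s) \tr ((F i)^T *m F i) <= (size s)%:R * \tr (P^T *m P).
    rewrite mulr_natl -iter_addr_0 -(count_predT s) -big_const_seq.
    by rewrite big_seq [leRHS]big_seq; exact: ler_sum.
  lra.
rewrite le_eqVlt ltNge sumr_ge0 ?orbF => [|j _]; last exact: frob_ge0.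
rewrite psumr_eq0 => [/allP/(_ i si)/= /eqP|j _]; last exact: frob_ge0.
by move=> e; apply/eqP; rewrite -subr_eq0; apply/eqP/frob_le0; rewrite e.
Qed.

(** [constant_orbit_inv] applied to the operator [pullback X] on the space of matrices: the starting
    row is [Q] and the observation is [pullback W]. *)
Lemma pullback_inv m (Q : 'M[R]_d) X (W : 'M[R]_(d, m)) K :
  X \in unitmx -> (forall n, pullback (iter n (mulmx X) W) Q = K) ->
  pullback (invmx X *m W) Q = K.
Proof.
move=> Xu H.
pose Y := lin_mx (pullback X : 'M[R]_d -> 'M[R]_d).
pose Yi := lin_mx (pullback (invmx X) : 'M[R]_d -> 'M[R]_d).
have YE (Z : 'M[R]_d) : mxvec Z *m Y = mxvec (pullback X Z).
  by rewrite mul_vec_lin.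
have YiE (Z : 'M[R]_d) : mxvec Z *m Yi = mxvec (pullback (invmx X) Z).
  by rewrite mul_vec_lin.
have YYi : Y *m Yi = 1%:M.
  apply/row_matrixP => k; rewrite row_mul !rowE mulmx1.
  set e := delta_mx _ _; rewrite -[e]vec_mxK YE YiE -pullback_mul mulmxV//.
  by rewrite /pullback trmx1 mul1mx mulmx1.
have [Yu _] := mulmx1_unit YYi.
have YiV : invmx Y = Yi by rewrite -[RHS](mulKmx Yu) YYi mulmx1.
pose v := lin_mx (pullback W : 'M[R]_d -> 'M[R]_m).
have vE (Z : 'M[R]_d) : mxvec Z *m v = mxvec (pullback W Z) by rewrite mul_vec_lin.
have iterE n : iter n (mulmxr Y) (mxvec Q) = mxvec (iter n (pullback X) Q).
  by elim: n => //= n ->; rewrite YE.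
have pullE n (M : 'M[R]_(d, m)) :
    pullback M (iter n (pullback X) Q) = pullback (iter n (mulmx X) M) Q.
  by elim: n M => //= n IH M; rewrite -pullback_mul IH -iterSr.
have := @constant_orbit_inv R _ _ _ Y (mxvec Q) v (mxvec K) Yu.
rewrite YiV YiE vE -pullback_mul => E; apply: (can_inj mxvecK); apply: E => n.
by rewrite iterE vE pullE H.
Qed.

(** [Q] is only the mean of its pullbacks so far. To make each pullback equal to [Q], one looks at a
    point [M0] of the closure where the pullback is extremal and shows that it can be cancelled. *)
Lemma bounded_semigroup_form L (C c : R) : L <> [::] ->
  (forall X, X \in L -> X \in unitmx) -> irreducible_mxset [set` L] ->
  (forall M, gen [set` L] M -> `|M| <= C) -> 0 < c ->
  (forall M, gen [set` L] M -> c <= `|M|) ->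
  exists2 Q, pos_def Q & forall X, X \in L -> pullback X Q = Q.
Proof.
move=> L0 unitL irrL ubL c0 lbL.
have [Q [Q1 Q2 Q3 TQ]] := invariant_cesaro_form L0 ubL c0 lbL.
have pdQ := transfer_pos_def L0 irrL Q1 Q2 Q3 TQ.
have [G Gu QG] := pos_def_factor pdQ.
exists Q => //.
pose S := gen [set` L]; pose K := closure S.
have Sunit M : S M -> M \in unitmx by apply: gen_unit => X; exact: unitL.
have cid : continuous (fun Q : 'M[R]_d => Q) by move=> x; exact: cvg_id.
have cconst (V W : topologicalType) (a : W) : continuous (fun _ : V => a).
  exact: cst_continuous.
have cnorm : continuous (fun M : 'M[R]_d => `|M|) by exact: norm_continuous.
have ubK : K `<=` [set M | `|M| <= C].
  by apply: closure_min; [exact: closed_le_fun cnorm (cconst _ _ _)|exact: ubL].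
have lbK : K `<=` [set M | c <= `|M|].
  by apply: closure_min; [exact: closed_le_fun (cconst _ _ _) cnorm|exact: lbL].
have clK : closed K by exact: closed_closure.
have cK : compact K by exact: mx_compact ubK clK.
have KX X M : X \in L -> K M -> K (X *m M).
  move=> XL; apply: (@closure_min _ _ [set M | K (X *m M)]).
    apply: (@closed_comp _ _ (fun M => X *m M) K) => // t _.
    exact: (mulmx_continuous (cconst _ _ X) cid).
  by move=> {}M SM; apply: subset_closure; exact: genM.
pose f M := \tr ((pullback M Q)^T *m pullback M Q).
have cf : {within K, continuous f}.
  apply: continuous_subspaceT; apply: mxtrace_continuous.
  have cp : continuous (fun M => pullback M Q).
    exact: (pullback_continuous cid (cconst _ _ Q)).
  exact: mulmx_continuous (trmx_continuous cp) cp.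
have K1 : K 1%:M by apply: subset_closure; exact: gen1.
have [M0 KM0 maxM0] : exists2 M0, K M0 & forall M, K M -> f M <= f M0.
  have [M0] := compact_EVT_max (ex_intro _ _ K1) cK cf.
  by rewrite inE => KM0 H; exists M0 => // M KM; apply: H; rewrite inE.
(* By strict convexity of the Frobenius norm, a maximal [pullback M0 Q] that is
   a mean of forms of at most its norm equals each of them. *)
have fixM X M : X \in L -> K M -> pullback M Q = pullback M0 Q ->
    pullback (X *m M) Q = pullback M0 Q.
  move=> XL KM QM.
  have PE : pullback M0 Q = mean [seq pullback (Y *m M) Q | Y <- L].
    rewrite -QM -[in LHS]TQ /transfer /mean !size_map !big_map linearZ /=.
    rewrite linear_sum; congr (_ *: _); apply: eq_bigr => Y _.
    by rewrite pullback_mul.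
  rewrite PE; apply: (@mean_extremal _ _ _ _ (fun Y => pullback (Y *m M) Q)) => //.
  by move=> Y YL; rewrite -PE; apply: maxM0; exact: KX.
have fixS M : S M -> K (M *m M0) /\ pullback (M *m M0) Q = pullback M0 Q.
  elim=> [|X M' XL _ [KM' IH]]; first by rewrite mul1mx.
  by rewrite -mulmxA; split; [exact: KX|exact: fixM].
(* The powers of [X] do not change [pullback (M *m M0) Q]; hence neither does
   the inverse of [X], and the inverses of the semigroup are bounded. *)
have fixinv X M : S X -> S M ->
    pullback (invmx X *m (M *m M0)) Q = pullback M0 Q.
  move=> SX SM; apply: pullback_inv; first exact: Sunit.
  move=> n; have -> : iter n (mulmx X) (M *m M0) = iter n (mulmx X) M *m M0.
    by elim: n => //= n ->; rewrite mulmxA.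
  apply: (fixS _ _).2; elim: n => //= n; exact: gen_mul.
(* As [Q = G^T G], the trace of the pullback is the squared Frobenius norm of [G W]; the bound
   [1 + t] follows from [a^2 <= t]. *)
have bdd (W : 'M[R]_d) : pullback W Q = pullback M0 Q ->
    `|W| <= d%:R * `|invmx G| * (1 + \tr (pullback M0 Q)).
  move=> WE; rewrite -{1}[W](mulKmx Gu) (le_trans (mx_norm_mulmx _ _))//.
  apply: ler_wpM2l; first by rewrite mulr_ge0.
  have := frob_ge (G *m W).
  have -> : (G *m W)^T *m (G *m W) = pullback M0 Q.
    by rewrite -WE /pullback QG trmx_mul !mulmxA.
  have := normr_ge0 (G *m W); set a := `|_|; set t := \tr _.
  by move=> a0 h; nra.
(* The matrices [Z] with bounded products [X^-1 M Z] satisfy the closure conditions of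
   [irreducible_ideal]; [M0] is one of them, hence so is the identity. *)
pose I : set 'M[R]_d := [set Z | exists D : R, forall X M, S X -> S M ->
  `|invmx X *m (M *m Z)| <= D].
have [D HD] : I 1%:M.
  apply: (@irreducible_ideal _ _ _ I irrL _ _ _ M0).
  - move=> Y Z [D1 H1] [D2 H2]; exists (D1 + D2) => X M SX SM.
    rewrite !mulmxDr (le_trans (ler_normD _ _))//.
    by apply: lerD; [exact: H1|exact: H2].
  - move=> Z W [D1 H1]; exists (d%:R * D1 * `|W|) => X M SX SM.
    rewrite !mulmxA (le_trans (mx_norm_mulmx _ _))// ler_wpM2r// ler_wpM2l//.
    by rewrite -mulmxA; exact: H1.
  - move=> X Z XL [D1 H1]; exists D1 => Y M SY SM.
    rewrite (mulmxA M); apply: H1 => //; apply: gen_mul => //.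
    by rewrite -[X]mulmx1; apply: genM => //; exact: gen1.
  - exists (d%:R * `|invmx G| * (1 + \tr (pullback M0 Q))) => X M SX SM.
    by apply: bdd; exact: fixinv.
  - by move=> M00; have := lbK _ KM0; rewrite M00 /= normr0 leNgt c0.
(* On the semigroup [|M^-1| <= D], so [|x| <= d D |M x|]. This is a closed condition on [M], so it
   holds at [M0]. *)
have M0u : M0 \in unitmx.
  apply: unitmx_inj => x M0x; apply/eqP; rewrite -normr_eq0 eq_le normr_ge0 andbT.
  have : K `<=` [set M | `|x| <= d%:R * D * `|M *m x|].
    apply: closure_min.
      apply: closed_le_fun (cconst _ _ _) _ => t.
      have cx : continuous (fun M : 'M[R]_d => M *m x).
        exact: mulmx_continuous cid (cconst _ _ _).
      apply: (continuousM (@cst_continuous _ _ _ t)).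
      exact: (continuous_comp (cx t) (@norm_continuous _ _ _)).
    move=> M SM /=; rewrite -{1}[x](mulKmx (Sunit _ SM)).
    rewrite (le_trans (mx_norm_mulmx _ _))// ler_wpM2r// ler_wpM2l//.
    by have := HD _ _ SM (gen1 _); rewrite !mulmx1.
  by move=> /(_ _ KM0) /=; rewrite M0x normr0 mulr0.
move=> X XL; have := fixM X M0 XL KM0 erefl.
rewrite pullback_mul {1 3}/pullback => /(congr1 (fun N => N *m invmx M0)).
rewrite !mulmxK// => /(congr1 (fun N => invmx M0^T *m N)).
by rewrite !mulKmx ?unitmx_tr.
Qed.

End InvariantForm.

(** * Words and cycles *)

Section Words.
Variables (R : realType) (d N : nat).
Implicit Types (A : 'I_N -> 'M[R]_d) (P : 'M[R]_N) (u w : seq 'I_N).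

Lemma word_prod_cat A u w : word_prod A (u ++ w) = word_prod A w *m word_prod A u.
Proof.
rewrite /word_prod foldl_cat; move: (foldl _ _ u) => M.
elim/last_ind: w => [|w j IH]; first by rewrite mul1mx.
by rewrite !foldl_rcons IH mulmxA.
Qed.

Lemma word_prod1 A i : word_prod A [:: i] = A i.
Proof. exact: mulmx1. Qed.

Lemma word_prod_cons A i w : word_prod A (i :: w) = word_prod A w *m A i.
Proof. by rewrite -cat1s word_prod_cat word_prod1. Qed.

Lemma word_prod_unit A w : (forall i, A i \in unitmx) -> word_prod A w \in unitmx.
Proof.
move=> Au; elim: w => [|i w IH]; first exact: unitmx1.
by rewrite word_prod_cons unitmx_mul IH Au.
Qed.

Lemma word_prod_scale A (a : R) w :
  word_prod (fun i => a *: A i) w = a ^+ size w *: word_prod A w.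
Proof.
elim: w => [|i w IH]; first by rewrite expr0 scale1r.
by rewrite !word_prod_cons IH -scalemxAl -scalemxAr scalerA exprSr.
Qed.

Lemma path_weight_cat P i u w :
  path_weight P i (u ++ w) = path_weight P i u * path_weight P (last i u) w.
Proof. by elim: u i => [|j u IH] i /=; rewrite ?mul1r// IH mulrA. Qed.

Lemma path_weight_ge0 P i w : (forall i j, 0 <= P i j) -> 0 <= path_weight P i w.
Proof. by move=> P0; elim: w i => //= j w IH i; rewrite mulr_ge0. Qed.

Lemma path_weight_gt0 P i w : path (fun i j => 0 < P i j) i w -> 0 < path_weight P i w.
Proof. by elim: w i => //= j w IH i /andP[ij jw]; rewrite mulr_gt0// IH. Qed.

(** If [j] is not reachable from [i], list the vertices unreachable from [i] first and the reachable
    ones, [U], last. No edge leaves [U], so the lower left block vanishes. *)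
Lemma strongly_connected_connect P : (forall i j, 0 <= P i j) ->
  strongly_connected P -> forall i j, connect (fun i j => 0 < P i j) i j.
Proof.
move=> P0 Pc i j; apply/negPn/negP => nij; apply: Pc.
set e := (fun i j => 0 < P i j) in nij.
pose U := [set x | connect e i x]%SET; pose l := enum (~: U) ++ enum U.
have ul : uniq l.
  rewrite cat_uniq !enum_uniq /= andbT; apply/hasPn => x.
  by rewrite /= !mem_enum finset.in_setC negbK.
have sl : size l = N.
  by rewrite size_cat -!cardE addnC cardsC card_ord.
(* The default value [a] is never reached, since [l] has [N] entries. *)
pose f (a : 'I_N) := nth a l a.
have finj : injective f.
  move=> a b; rewrite /f (set_nth_default a b) ?sl// => /eqP.
  by rewrite nth_uniq ?sl// => /eqP/val_inj.
have fU a : (f a \in U) = (#|~: U| <= a)%N.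
  rewrite /f nth_cat -cardE ltnNge; case: leqP => h /=.
    rewrite -mem_enum mem_nth// -cardE ltn_subLR//.
    by rewrite addnC cardsC card_ord.
  by apply/negbTE; rewrite -finset.in_setC -mem_enum mem_nth// -cardE.
exists (perm finj), #|~: U|; split.
  apply/andP; split; first by apply/card_gt0P; exists j; rewrite !inE.
  have UN : (#|U| + #|~: U| = N)%N by rewrite cardsC card_ord.
  rewrite -[ltnRHS]UN -[ltnLHS]add0n ltn_add2r.
  by apply/card_gt0P; exists i; rewrite inE connect0.
move=> a b ka kb; set s := perm finj.
have su : (perm_mx s : 'M[R]_N) \in unitmx by exact: unitmx_perm.
have -> : invmx (perm_mx s) = perm_mx s^-1%g :> 'M[R]_N.
  by rewrite -[RHS](mulKmx su) -perm_mxM mulgV perm_mx1 mulmx1.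
rewrite -row_permE -col_permE !mxE !permE.
have aU : f a \in U by rewrite fU.
have bU : f b \notin U by rewrite fU -ltnNge.
apply/eqP; rewrite eq_le P0 andbT leNgt; apply: contra bU => ab.
rewrite !inE in aU *; apply: connect_trans aU (connect1 _); exact: ab.
Qed.

Record is_mxgroup (H : set 'M[R]_d) : Prop := IsMxgroup {
  mxgroup1 : H 1%:M;
  mxgroupM : forall M L, H M -> H L -> H (M *m L);
  mxgroupV : forall M, H M -> H (invmx M) }.

Lemma mxgroup_word H A w : is_mxgroup H -> (forall i, i \in w -> H (A i)) ->
  H (word_prod A w).
Proof.
move=> gH; elim: w => [_|i w IH Hw]; first exact: mxgroup1 gH.
rewrite word_prod_cons; apply: (mxgroupM gH); last by apply: Hw; rewrite inE eqxx.
by apply: IH => j jw; apply: Hw; rewrite inE jw orbT.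
Qed.

(* If [Z A_j W] and [Z A_j A_j W] are both cycle products, then the group they
   generate together with [W] contains [A_j]; this is where the positive
   diagonal is used. *)
Lemma cycle_generators A P s : (forall i, A i \in unitmx) ->
  (forall i j, 0 <= P i j) -> (forall i, 0 < P i i) -> strongly_connected P ->
  exists L : seq 'M[R]_d, (forall M, M \in L -> cycle_products A P s M) /\
    forall H, is_mxgroup H -> (forall M, M \in L -> H M) -> forall i, H (A i).
Proof.
move=> Au P0 Pd /strongly_connected_connect -/(_ P0) conn.
have back j : exists w, 0 < path_weight P j (rcons w s).
  have /connectP[q] := conn j s; case/lastP: q => [|q k] pq.
    by move=> /= ->; exists [::]; rewrite /= mulr1.
  by rewrite last_rcons => ->; exists q; exact: path_weight_gt0.
have good p : path (fun i j => 0 < P i j) s p ->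
  exists L : seq 'M[R]_d, (forall M, M \in L -> cycle_products A P s M) /\
    forall H, is_mxgroup H -> (forall M, M \in L -> H M) ->
    forall i, i \in s :: p -> H (A i).
  elim/last_ind: p => [_|p j IH].
    exists [:: A s]; split=> [M|H gH HL i].
      rewrite inE => /eqP ->; exists [::]; last exact: word_prod1.
      by rewrite /= /P_cycle /= mulr1.
    by rewrite inE => /eqP ->; apply: HL; exact: mem_head.
  rewrite rcons_path => /andP[pp pj]; have [L [Lc LH]] := IH pp.
  have [w wP] := back j.
  pose W := word_prod A (s :: p); pose Z := word_prod A w.
  have M1E : word_prod A (s :: (p ++ j :: w)) = Z *m A j *m W.
    by rewrite -cat_cons word_prod_cat (word_prod_cons A j).
  have M2E : word_prod A (s :: (p ++ j :: j :: w)) = Z *m A j *m A j *m W.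
    by rewrite -cat_cons word_prod_cat !(word_prod_cons A j).
  (* Both cycles follow [p] to [j] and return to [s] by [w]; the second one uses the loop at [j]
     once. *)
  exists [:: Z *m A j *m W, Z *m A j *m A j *m W & L]; split=> [M|H gH HL].
    rewrite !inE => /or3P[/eqP ->|/eqP ->|]; last exact: Lc.
      exists (p ++ j :: w) => //; rewrite /= /P_cycle rcons_cat path_weight_cat.
      by apply: mulr_gt0; [exact: path_weight_gt0|apply: mulr_gt0].
    exists (p ++ j :: j :: w) => //; rewrite /= /P_cycle rcons_cat path_weight_cat.
    apply: mulr_gt0; [exact: path_weight_gt0|apply: mulr_gt0 => //].
    by apply: mulr_gt0.
  have Hp i : i \in s :: p -> H (A i).
    by apply: LH => // M ML; apply: HL; rewrite !inE ML !orbT.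
  move=> i; rewrite -rcons_cons mem_rcons inE => /orP[/eqP -> {i}|]; last exact: Hp.
  have WH : H (invmx W) by apply: (mxgroupV gH); exact: mxgroup_word.
  have h1 : H (Z *m A j).
    rewrite -[Z *m A j](mulmxK (word_prod_unit (s :: p) Au)) -/W.
    by apply: (mxgroupM gH) => //; apply: HL; rewrite !inE eqxx.
  have h2 : H (Z *m A j *m A j).
    rewrite -[Z *m A j *m A j](mulmxK (word_prod_unit (s :: p) Au)) -/W.
    by apply: (mxgroupM gH) => //; apply: HL; rewrite !inE eqxx orbT.
  have ZAu : Z *m A j \in unitmx by rewrite unitmx_mul word_prod_unit// Au.
  (* [A j] is the quotient of [Z A_j A_j] by [Z A_j]. *)
  rewrite -[A j](mulKmx ZAu); apply: (mxgroupM gH) => //; exact: (mxgroupV gH).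
have goodi i : exists L : seq 'M[R]_d,
    (forall M, M \in L -> cycle_products A P s M) /\
    forall H, is_mxgroup H -> (forall M, M \in L -> H M) -> H (A i).
  have /connectP[p pp ip] := conn s i; have [L [Lc LH]] := good p pp.
  by exists L; split=> // H gH HL; apply: (LH H gH HL); rewrite ip mem_last.
have [L HL] := choice goodi.
exists (flatten [seq L i | i <- enum 'I_N]); split=> [M /flatten_mapP[i _]|H gH HH i].
  by have [Lc _] := HL i; exact: Lc.
have [_ ] := HL i; apply=> // M ML; apply: HH; apply/flatten_mapP.
by exists i; rewrite ?mem_enum.
Qed.

(** For inverses: an injective [M] that maps [V] into [V] maps it onto [V], by dimension. *)
Lemma stabilizer_mxgroup (V : {vspace 'cV[R]_d}) :
  is_mxgroup [set M | M \in unitmx /\ forall x, x \in V -> M *m x \in V].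
Proof.
split=> [|M L [Mu MV] [Lu LV]|M [Mu MV]] /=.
- by split=> [|x]; [exact: unitmx1|rewrite mul1mx].
- by split=> [|x xV]; [rewrite unitmx_mul Mu|rewrite -mulmxA MV// LV].
- split=> [|x xV]; first by rewrite unitmx_inv.
  pose f := linfun (mulmx M : 'cV[R]_d -> 'cV[R]_d).
  have fV : (f @: V <= V)%VS.
    by apply/subvP => _ /memv_imgP[y yV ->]; rewrite lfunE; exact: MV.
  have kf : (V :&: lker f)%VS = 0%VS.
    apply/eqP; rewrite -subv0; apply/subvP => y; rewrite memv_cap memv_ker lfunE /=.
    by move=> /andP[_ /eqP My]; rewrite memv0 -[y](mulKmx Mu) My mulmx0.
  have : x \in (f @: V)%VS.
    by have /eqP -> : (f @: V == V)%VS by rewrite eqEdim fV (limg_dim_eq kf) /=.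
  by move=> /memv_imgP[y yV ->]; rewrite lfunE /= mulKmx.
Qed.

(** The stabilizer of a subspace invariant under [S] is a group containing [S], hence all the
    [A i]. *)
Lemma irreducible_generators A (S : set 'M[R]_d) :
  irreducible_mxset (range A) -> S `<=` [set M | M \in unitmx] ->
  (forall H, is_mxgroup H -> S `<=` H -> forall i, H (A i)) -> irreducible_mxset S.
Proof.
move=> irrA Su SA V SV; apply: irrA => _ [i _ <-].
have [] // := SA _ (stabilizer_mxgroup V) _ i.
by move=> M SM; split; [exact: Su|exact: SV].
Qed.

Lemma cycle_products_unit A P s : (forall i, A i \in unitmx) ->
  cycle_products A P s `<=` [set M | M \in unitmx].
Proof. by move=> Au _ [w _ <-]; exact: word_prod_unit. Qed.

End Words.

(** * Upper limits and operator norms *)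

Section LimSup.
Variable R : realType.
Implicit Types (u : nat -> R) (a b c : R).

Lemma limn_sup_le u b c : (forall n, `|u n| <= c) ->
  (\forall n \near \oo, u n <= b) -> limn_sup u <= b.
Proof.
move=> uc [n0 _ ub].
have bu : bounded_fun (u : nat -> R^o).
  by exists c; split; [exact: num_real|move=> x cx n _; exact: le_trans (uc n) (ltW cx)].
rewrite (limn_supE bu).
apply: le_trans (_ : sups u n0 <= b).
  by apply: ge_inf; [exact: bounded_fun_has_lbound_sups|exists n0].
apply: ge_sup; first by exists (u n0), n0 => /=.
by move=> _ [k /= n0k <-]; exact: ub.
Qed.

Lemma limn_sup_ge u a c : (forall n, `|u n| <= c) ->
  (forall n, exists2 m, (n <= m)%N & a <= u m) -> a <= limn_sup u.
Proof.
move=> uc ua.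
have bu : bounded_fun (u : nat -> R^o).
  by exists c; split; [exact: num_real|move=> x cx n _; exact: le_trans (uc n) (ltW cx)].
rewrite (limn_supE bu).
apply: lb_le_inf; first by exists (sups u 0), 0%N.
move=> _ [n _ <-]; have [m nm am] := ua n; apply: le_trans am _.
apply: ub_le_sup; last by exists m.
by exists c => _ [k _ <-]; exact: le_trans (ler_norm _) (uc k).
Qed.

Lemma cvg_powR_invn a : 0 < a -> (fun n => a `^ n.+1%:R^-1) @ \oo --> (1 : R).
Proof.
move=> a0.
have -> : (fun n => a `^ n.+1%:R^-1) = expR \o (fun n => n.+1%:R^-1 * ln a).
  by apply/funext => n /=; rewrite /powR gt_eqF.
suff : expR \o (fun n => n.+1%:R^-1 * ln a) @ \oo --> expR (0 * ln a).
  by rewrite mul0r expR0.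
apply: continuous_cvg; first exact: continuous_expR.
by apply: cvgM; [exact: cvg_harmonic|exact: cvg_cst].
Qed.

End LimSup.

Section OperatorNorm.
Variables (R : realType) (d : nat) (nrm : 'cV[R]_d -> R).
Hypothesis nrm_norm : is_norm nrm.
Implicit Types (x : 'cV[R]_d) (M : 'M[R]_d).

Let nrm_ge0 x : 0 <= nrm x. Proof. by case: nrm_norm. Qed.
Let nrmZ (a : R) x : nrm (a *: x) = `|a| * nrm x. Proof. by case: nrm_norm. Qed.
Let nrmD x y : nrm (x + y) <= nrm x + nrm y. Proof. by case: nrm_norm. Qed.

Lemma is_norm0 : nrm 0 = 0.
Proof. by rewrite -(scale0r 0) nrmZ normr0 mul0r. Qed.

Lemma is_norm_sum (I : Type) (s : seq I) (f : I -> 'cV[R]_d) :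
  nrm (\sum_(i <- s) f i) <= \sum_(i <- s) nrm (f i).
Proof.
elim: s => [|i s IH]; first by rewrite !big_nil is_norm0.
by rewrite !big_cons (le_trans (nrmD _ _))// lerD2l.
Qed.

Lemma is_norm_upper : exists2 K : R, 0 < K & forall x, nrm x <= K * `|x|.
Proof.
exists (\sum_i nrm (delta_mx i 0) + 1); first by rewrite ltr_wpDl// sumr_ge0.
move=> x; rewrite {1}[x]matrix_sum_delta.
under eq_bigr => i _ do rewrite big_ord1.
rewrite (le_trans (is_norm_sum _ _))// mulrDl mul1r -[leLHS]addr0 lerD//.
rewrite mulr_suml; apply: ler_sum => i _; rewrite nrmZ mulrC.
by rewrite ler_wpM2l// mx_norm_entry.
Qed.

Lemma is_norm_continuous : continuous nrm.
Proof.
have [K K0 HK] := is_norm_upper.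
have dist x y : nrm x - nrm y <= K * `|x - y|.
  by rewrite lerBlDr; apply: le_trans (lerD (HK _) (lexx _)); rewrite -{1}(subrK y x).
move=> x; apply/(@cvgrPdist_le _ _ _ (nbhs x) (nbhs_filter x)) => e e0.
have nb : nbhs x (ball x (e / K)) by apply: nbhsx_ballx; rewrite divr_gt0.
apply: filterS nb => y; rewrite -ball_normE => /= /ltW; rewrite ler_pdivlMr// mulrC => xy.
rewrite ler_norml (le_trans (dist _ _) xy) andbT lerNl opprB.
by apply: le_trans (dist _ _) _; rewrite distrC.
Qed.

(** The constant is the minimum of [nrm] on the unit sphere of the library norm, which is compact.
    The zero space, whose sphere is empty, is treated apart. *)
Lemma is_norm_lower : exists2 k : R, 0 < k & forall x, k * `|x| <= nrm x.
Proof.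
have [[y y0]|all0] := pselect (exists y : 'cV[R]_d, y != 0); last first.
  exists 1 => // x; have [->|x0] := eqVneq x 0; first by rewrite normr0 mulr0.
  by exfalso; apply: all0; exists x.
pose S : set 'cV[R]_d := [set x | `|x| <= 1] `&` [set x | 1 <= `|x|].
have cn : continuous (fun x : 'cV[R]_d => `|x|) by exact: norm_continuous.
have cc : continuous (fun x : 'cV[R]_d => 1 : R) by exact: cst_continuous.
have cS : compact S.
  apply: (@mx_compact _ _ _ _ 1); first by move=> x [].
  by apply: closedI; exact: closed_le_fun.
have normalize x : x != 0 -> S (`|x|^-1 *: x).
  move=> x0; have nx : `|x| != 0 by rewrite normr_eq0.
  by split; rewrite /= normrZ ger0_norm ?invr_ge0// mulVf.
have S0 : S !=set0 by exists (`|y|^-1 *: y); exact: normalize.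
have [c] := compact_EVT_min S0 cS (continuous_subspaceT is_norm_continuous).
rewrite inE => Sc minc.
have c0 : c != 0.
  by apply/eqP => c0; case: Sc => _ /=; rewrite c0 normr0 ler10.
exists (nrm c).
  rewrite lt_neqAle nrm_ge0 andbT eq_sym; apply: contra c0 => /eqP.
  by case: nrm_norm => _ h _ _ /h ->.
move=> x; have [->|x0] := eqVneq x 0; first by rewrite normr0 mulr0.
have nx : 0 < `|x| by rewrite normr_gt0.
have := minc (`|x|^-1 *: x); rewrite inE => /(_ (normalize _ x0)).
by rewrite nrmZ ger0_norm ?invr_ge0// mulrC ler_pdivlMr.
Qed.

Lemma opnorm_has_ubound M : has_ubound [set nrm (M *m x) | x in [set x | nrm x <= 1]].
Proof.
have [K K0 HK] := is_norm_upper; have [k k0 Hk] := is_norm_lower.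
exists (K * (d%:R * `|M| * k^-1)) => _ [x /= x1 <-].
apply: le_trans (HK _) _; rewrite ler_pM2l//.
apply: le_trans (mx_norm_mulmx _ _) _; apply: ler_wpM2l; first by rewrite mulr_ge0.
by rewrite -[leRHS]mul1r ler_pdivlMr// mulrC; apply: le_trans x1.
Qed.

Lemma opnorm_ge0 M : 0 <= opnorm nrm M.
Proof.
apply: ub_le_sup; first exact: opnorm_has_ubound.
by exists 0; rewrite /= ?mulmx0 is_norm0.
Qed.

Lemma opnorm_ub M x : nrm (M *m x) <= opnorm nrm M * nrm x.
Proof.
have [nx|nx] := eqVneq (nrm x) 0.
  case: nrm_norm => _ /(_ x nx) -> _ _.
  by rewrite mulmx0 is_norm0 mulr0.
have n0 : 0 < nrm x by rewrite lt_neqAle eq_sym nx nrm_ge0.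
rewrite -ler_pdivrMr//.
have -> : nrm (M *m x) / nrm x = nrm (M *m ((nrm x)^-1 *: x)).
  by rewrite -scalemxAr nrmZ ger0_norm ?invr_ge0// mulrC.
apply: ub_le_sup; first exact: opnorm_has_ubound.
exists ((nrm x)^-1 *: x) => //=.
by rewrite nrmZ ger0_norm ?invr_ge0// mulVf.
Qed.

Lemma opnorm_le M (b : R) : 0 <= b -> (forall x, nrm (M *m x) <= b * nrm x) ->
  opnorm nrm M <= b.
Proof.
move=> b0 H; apply: ge_sup; first by exists 0, 0; rewrite /= ?mulmx0 is_norm0.
move=> _ [x /= x1 <-]; apply: le_trans (H x) _.
by rewrite -[leRHS]mulr1 ler_wpM2l.
Qed.

Lemma opnorm_mul M L : opnorm nrm (M *m L) <= opnorm nrm M * opnorm nrm L.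
Proof.
apply: opnorm_le => [|x]; first by rewrite mulr_ge0 ?opnorm_ge0.
rewrite -mulmxA -mulrA; apply: le_trans (opnorm_ub _ _) _.
by rewrite ler_wpM2l ?opnorm_ge0 ?opnorm_ub.
Qed.

Lemma opnormZ (a : R) M : opnorm nrm (a *: M) = `|a| * opnorm nrm M.
Proof.
have le b L : opnorm nrm (b *: L) <= `|b| * opnorm nrm L.
  apply: opnorm_le => [|x]; first by rewrite mulr_ge0 ?opnorm_ge0.
  by rewrite -scalemxAl nrmZ -mulrA ler_wpM2l ?opnorm_ub.
apply/eqP; rewrite eq_le le /=.
have [->|a0] := eqVneq a 0; first by rewrite normr0 mul0r opnorm_ge0.
have := le a^-1 (a *: M); rewrite scalerA mulVf// scale1r normfV.
by rewrite mulrC ler_pdivlMr ?normr_gt0// mulrC.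
Qed.

Lemma opnorm1_le : opnorm nrm 1%:M <= 1.
Proof. by apply: opnorm_le => // x; rewrite mul1mx mul1r. Qed.

Lemma opnorm1_gt0 : (0 < d)%N -> 1 <= opnorm nrm 1%:M.
Proof.
case: d nrm nrm_norm opnorm_ub => // n nrm' [n_ge0 n0 _ _] ub _.
have e0 : 0 < nrm' (delta_mx 0 0).
  rewrite lt_neqAle n_ge0 andbT eq_sym; apply/eqP => /n0 /matrixP/(_ 0 0).
  by rewrite !mxE !eqxx /= => /eqP; rewrite oner_eq0.
by have := ub 1%:M (delta_mx 0 0); rewrite mul1mx -ler_pdivrMr// divff ?gt_eqF.
Qed.

Lemma opnorm_le_mx_norm : exists2 K : R, 0 < K & forall M, opnorm nrm M <= K * `|M|.
Proof.
have [K K0 HK] := is_norm_upper; have [k k0 Hk] := is_norm_lower.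
have P0 : 0 < K * (d%:R + 1) * k^-1 by rewrite !mulr_gt0 ?invr_gt0// ltr_wpDl.
exists (K * (d%:R + 1) * k^-1) => // M.
apply: opnorm_le => [|x]; first exact: mulr_ge0 (ltW P0) (normr_ge0 _).
apply: le_trans (HK _) _; rewrite -!mulrA ler_pM2l//.
apply: le_trans (mx_norm_mulmx _ _) _; rewrite -mulrA.
apply: (@le_trans _ _ ((d%:R + 1) * (`|M| * `|x|))).
  by rewrite ler_wpM2r ?mulr_ge0// lerDl.
rewrite ler_wpM2l ?addr_ge0//.
by rewrite mulrCA ler_wpM2l// mulrC ler_pdivlMr// mulrC.
Qed.

Lemma mx_norm_le_opnorm : exists2 K : R, 0 < K & forall M, `|M| <= K * opnorm nrm M.
Proof.
have [K K0 HK] := is_norm_upper; have [k k0 Hk] := is_norm_lower.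
exists (K / k); first by rewrite divr_gt0.
move=> M; apply: mx_norm_le => [|i j].
  by rewrite mulr_ge0 ?opnorm_ge0// divr_ge0 ?ltW.
have -> : M i j = (M *m (delta_mx j 0 : 'cV[R]_d)) i 0 by rewrite -colE mxE.
apply: le_trans (mx_norm_entry _ _ _) _.
rewrite mulrAC ler_pdivlMr// mulrC; apply: le_trans (Hk _) _.
apply: le_trans (opnorm_ub _ _) _; rewrite mulrC ler_wpM2r ?opnorm_ge0//.
apply: le_trans (HK _) _; rewrite -[leRHS]mulr1 ler_pM2l//.
apply: mx_norm_le => // a b; rewrite mxE.
by case: (_ && _); rewrite ?normr1 ?normr0.
Qed.

End OperatorNorm.

(** * The joint spectral radius *)

Section Roots.
Variable R : realType.

Lemma powR_invnK (y : R) n : 0 <= y -> (y ^+ n.+1) `^ n.+1%:R^-1 = y.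
Proof.
by move=> y0; rewrite -powR_mulrn// -powRrM divff ?pnatr_eq0// powRr1.
Qed.

Lemma powR_invnXK (y : R) n : 0 <= y -> (y `^ n.+1%:R^-1) ^+ n.+1 = y.
Proof.
move=> y0.
by rewrite -powR_mulrn ?powR_ge0// -powRrM mulVf ?pnatr_eq0// powRr1.
Qed.

Lemma powR_invn_le (x y : R) n : 0 <= x -> 0 <= y -> x <= y ^+ n.+1 ->
  x `^ n.+1%:R^-1 <= y.
Proof.
move=> x0 y0 xy; rewrite -[leRHS](powR_invnK n y0).
by rewrite ge0_ler_powR ?nnegrE ?invr_ge0 ?exprn_ge0.
Qed.

Lemma powR_invn_ge (x y : R) n : 0 <= y -> y ^+ n.+1 <= x -> y <= x `^ n.+1%:R^-1.
Proof.
move=> y0 yx; rewrite -[leLHS](powR_invnK n y0).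
rewrite ge0_ler_powR ?nnegrE ?invr_ge0 ?exprn_ge0//.
by apply: le_trans yx; rewrite exprn_ge0.
Qed.

End Roots.

Section JointSpectralRadius.
Variables (R : realType) (d N : nat) (nrm : 'cV[R]_d -> R).
Hypothesis nrm_norm : is_norm nrm.
Implicit Types (A : 'I_N -> 'M[R]_d) (w : seq 'I_N) (n : nat).

Lemma opnorm_word_le A (m : R) w : (forall i, opnorm nrm (A i) <= m) ->
  opnorm nrm (word_prod A w) <= m ^+ size w.
Proof.
move=> Am; elim: w => [|i w IH]; first by rewrite opnorm1_le.
rewrite word_prod_cons (le_trans (opnorm_mul _ _ _))//= exprSr.
by rewrite ler_pM ?opnorm_ge0.
Qed.

Lemma opnorm_letters_ub A : exists2 m : R, 0 <= m & forall i, opnorm nrm (A i) <= m.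
Proof.
exists (\sum_i opnorm nrm (A i)); first by apply: sumr_ge0 => i _; exact: opnorm_ge0.
move=> i; rewrite (bigD1 i)//= lerDl; apply: sumr_ge0 => j _; exact: opnorm_ge0.
Qed.

Lemma opnorm_root_le A (m : R) n (w : n.+1.-tuple 'I_N) : 0 <= m ->
  (forall i, opnorm nrm (A i) <= m) ->
  opnorm nrm (word_prod A w) `^ n.+1%:R^-1 <= m.
Proof.
move=> m0 Am; apply: powR_invn_le => //; first exact: opnorm_ge0.
by rewrite -[in leRHS](size_tuple w); exact: opnorm_word_le.
Qed.

Lemma rho_d_ge A (a : R) : 0 <= a ->
  (forall n, exists2 w, (n <= size w)%N & a ^+ size w <= opnorm nrm (word_prod A w)) ->
  a <= rho_d nrm A.
Proof.
move=> a0 H; have [m m0 Am] := opnorm_letters_ub A.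
apply: (@limn_sup_ge _ _ _ m).
  move=> n; rewrite ger0_norm; last first.
    by elim/big_ind : _ => // [x y x0 y0|w _]; [rewrite le_max x0|exact: powR_ge0].
  by apply: bigmax_le => // w _; exact: opnorm_root_le.
(* The term of index [n] concerns words of length [n + 1]; asking for length at least [n + 1] yields
   a nonempty word [i :: w], whose index is [size w]. *)
move=> n; have [w nw aw] := H n.+1.
case: w nw aw => // i w nw aw; exists (size w) => //.
apply: le_trans (le_bigmax _ _ (in_tuple (i :: w))) => /=.
exact: powR_invn_ge.
Qed.

(** Powers of one letter suffice: [1 <= |A_i^n| b^n] with [b] the norm of the inverse of [A_i], so
    the radius is at least [1 / b]. *)
Lemma rho_d_gt0 A : (0 < d)%N -> (0 < N)%N -> (forall i, A i \in unitmx) ->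
  0 < rho_d nrm A.
Proof.
move=> d0 N0 Au; pose i := Ordinal N0.
set b := opnorm nrm (invmx (A i)).
have step n : 1 <= opnorm nrm (word_prod A (nseq n i)) * b ^+ n.
  elim: n => [|n IH]; first by rewrite mulr1 opnorm1_gt0.
  apply: le_trans IH _; rewrite exprS mulrA.
  rewrite ler_wpM2r ?exprn_ge0 ?opnorm_ge0//.
  rewrite -[leLHS]/(opnorm nrm (word_prod A (nseq n i))).
  rewrite -[X in opnorm nrm X](mulmxK (Au i)) -word_prod_cons.
  exact: opnorm_mul.
have b0 : 0 < b.
  have := step 1%N; rewrite expr1; have := opnorm_ge0 nrm_norm (invmx (A i)).
  by rewrite -/b le_eqVlt => /orP[/eqP <-|//]; rewrite mulr0 ler10.
apply: (@lt_le_trans _ _ b^-1); first by rewrite invr_gt0.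
apply: rho_d_ge => [|n]; first by rewrite invr_ge0 ltW.
exists (nseq n i); rewrite size_nseq//.
by rewrite exprVn -div1r ler_pdivrMr ?exprn_gt0.
Qed.

(* Either some nonzero vector has a bounded orbit, and then so do all; or, by
   compactness of the sphere, words of bounded length double every vector. *)
Lemma irreducible_bounded_or_growing A : (0 < d)%N -> irreducible_mxset (range A) ->
  (exists C : R, forall w, `|word_prod A w| <= C) \/
  (exists2 a : R, 1 < a & forall n, exists2 w, (n <= size w)%N &
     a ^+ size w <= opnorm nrm (word_prod A w)).
Proof.
move=> d0 irrA.
have [k k0 Hk] := is_norm_lower nrm_norm.
have nge0 y : 0 <= nrm y by case: nrm_norm.
have ngt0 y : y != 0 -> 0 < nrm y.
  move=> y0; rewrite lt_neqAle nge0 andbT eq_sym; apply: contra y0 => /eqP.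
  by case: nrm_norm => _ h _ _ /h ->.
have [[x [x0 [D HD]]]|unb] := pselect (exists x, x != 0 /\
    exists D, forall w, nrm (word_prod A w *m x) <= D).
  left; pose I : set 'M[R]_d := [set Z | exists D : R, forall w, `|word_prod A w *m Z| <= D].
  suff [C HC] : I 1%:M by exists C => w; have := HC w; rewrite mulmx1.
  (* The nonzero matrix all of whose columns are [x] has a bounded orbit, and the matrices with
     bounded orbit satisfy the closure conditions of [irreducible_ideal]. *)
  apply: (@irreducible_ideal _ _ _ I irrA _ _ _ (x *m (const_mx 1 : 'rV_d))).
  - move=> Y Z [D1 H1] [D2 H2]; exists (D1 + D2) => w.
    by rewrite mulmxDr (le_trans (ler_normD _ _))// lerD.
  - move=> Z W [D1 H1]; exists (d%:R * D1 * `|W|) => w.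
    by rewrite mulmxA (le_trans (mx_norm_mulmx _ _))// ler_wpM2r// ler_wpM2l.
  - move=> _ Z [i _ <-] [D1 H1]; exists D1 => w.
    by rewrite mulmxA -word_prod_cons.
  - exists (1%:R * (D / k) * `|const_mx 1 : 'rV[R]_d|) => w.
    rewrite mulmxA (le_trans (mx_norm_mulmx _ _))// ler_wpM2r// ler_wpM2l//.
    by rewrite ler_pdivlMr// mulrC; apply: le_trans (Hk _) _.
  - move=> /matrixP E; move/eqP: x0; apply; apply/matrixP => i j.
    have := E i (Ordinal d0); rewrite !mxE big_ord1 mxE mulr1 => <-.
    by rewrite ord1.
right.
pose S : set 'cV[R]_d := [set x | `|x| <= 1] `&` [set x | 1 <= `|x|].
have cn : continuous (fun x : 'cV[R]_d => `|x|) by exact: norm_continuous.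
have cc : continuous (fun x : 'cV[R]_d => 1 : R) by exact: cst_continuous.
have cS : compact S.
  apply: (@mx_compact _ _ _ _ 1); first by move=> x [].
  by apply: closedI; exact: closed_le_fun.
(* Otherwise, for every [L], some point of the sphere is not doubled by words of length at most [L];
   a cluster point of these has its orbit bounded by twice its norm. *)
have [L HL] : exists L, forall x, S x -> exists2 w, (size w <= L)%N &
    2 * nrm x <= nrm (word_prod A w *m x).
  apply: contrapT => nL.
  have bad L : exists x, S x /\ forall w, (size w <= L)%N ->
      nrm (word_prod A w *m x) <= 2 * nrm x.
    apply: contrapT => nx; apply: nL; exists L => x Sx; apply: contrapT => nw.
    apply: nx; exists x; split=> // w wL; rewrite leNgt; apply/negP => lt.
    by apply: nw; exists w => //; exact: ltW.
  have [u Hu] := choice bad.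
  have [x Sx Hx] := compact_seq_closed cS (fun n => (Hu n).1).
  apply: unb; exists x; split.
    by apply/eqP => x0; case: Sx => _ /=; rewrite x0 normr0 ler10.
  exists (2 * nrm x) => w.
  apply: (Hx [set x | nrm (word_prod A w *m x) <= 2 * nrm x]).
    have cx : continuous (fun x : 'cV[R]_d => word_prod A w *m x).
      by apply: mulmx_continuous; [exact: cst_continuous|move=> t; exact: cvg_id].
    apply: closed_le_fun => t.
      exact: (continuous_comp (cx t) (is_norm_continuous nrm_norm (x := _))).
    exact: (continuousM (@cst_continuous _ _ _ t) (is_norm_continuous nrm_norm (x := t))).
  by exists (size w) => // n /= wn; apply: (Hu n).2.
(* Homogeneity extends this to all nonzero vectors. The empty word doubles none of them, so the
   words found are nonempty and their concatenations become arbitrarily long. *)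
have HL' x : x != 0 -> exists w, [/\ (0 < size w)%N, (size w <= L.+1)%N &
    2 * nrm x <= nrm (word_prod A w *m x)].
  move=> x0; have nx : 0 < `|x| by rewrite normr_gt0.
  have nZ (a : R) y : nrm (a *: y) = `|a| * nrm y by case: nrm_norm.
  have [|w wL] := HL (`|x|^-1 *: x).
    by split; rewrite /= normrZ ger0_norm ?invr_ge0// mulVf// gt_eqF.
  rewrite -scalemxAr !nZ mulrCA ler_pM2l ?normr_gt0 ?invr_neq0 ?gt_eqF// => H.
  exists w; split=> //; last exact: leqW.
  case: w H {wL} => // H; have := ngt0 x x0; rewrite /= mul1mx in H.
  by move=> h; exfalso; lra.
pose x0 : 'cV[R]_d := const_mx 1.
have x00 : x0 != 0.
  apply/eqP => /matrixP /(_ (Ordinal d0) 0); rewrite !mxE => /eqP.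
  by rewrite oner_eq0.
have iterw n : exists w, [/\ (n <= size w)%N, (size w <= n * L.+1)%N &
    2 ^+ n * nrm x0 <= nrm (word_prod A w *m x0)].
  elim: n => [|n [w [nw wn Hw]]].
    by exists [::]; rewrite /= mul1mx mul1r.
  have y0 : word_prod A w *m x0 != 0.
    apply/eqP => y0; move: Hw; rewrite y0 (is_norm0 nrm_norm) leNgt.
    by rewrite mulr_gt0 ?ngt0 ?exprn_gt0.
  have [v [v0 vL Hv]] := HL' _ y0.
  exists (w ++ v); rewrite size_cat; split.
  - by rewrite -addn1 leq_add.
  - by rewrite mulSn addnC leq_add.
  - rewrite word_prod_cat -mulmxA; apply: le_trans Hv.
    by rewrite exprS -mulrA ler_pM2l.
(* [n] doublings take at most [n (L + 1)] letters, so the growth per letter is at least the root of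
   2 of order [L + 1]. *)
have [a a0 aL] : exists2 a : R, 0 <= a & a ^+ L.+1 = 2.
  exists (2 `^ L.+1%:R^-1); first exact: powR_ge0.
  exact: powR_invnXK.
have a1 : 1 < a.
  rewrite ltNge; apply/negP => ale1.
  by have := exprn_ile1 L.+1 a0 ale1; rewrite aL lern1.
exists a => // n; have [w [nw wn Hw]] := iterw n; exists w => //.
have H2 : 2 ^+ n <= opnorm nrm (word_prod A w).
  by rewrite -(ler_pM2r (ngt0 _ x00)); apply: le_trans Hw _; exact: opnorm_ub.
apply: le_trans H2; apply: le_trans (ler_weXn2l (ltW a1) wn) _.
by rewrite mulnC exprM aL.
Qed.

(** Growth of the scaled products at a rate [a > 1] would give [a r <= r] for the radius [r]. *)
Lemma scaled_products_bounded A : (0 < d)%N -> irreducible_mxset (range A) ->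
  0 < rho_d nrm A ->
  exists C : R, forall w, `|word_prod (fun i => (rho_d nrm A)^-1 *: A i) w| <= C.
Proof.
move=> d0 irrA r0; set r := rho_d nrm A.
pose B i := r^-1 *: A i.
have irrB : irreducible_mxset (range B).
  move=> V HV; apply: irrA => _ [i _ <-] x xV.
  have -> : A i = r *: B i by rewrite /B scalerA divff ?gt_eqF// scale1r.
  by rewrite -scalemxAl; apply: rpredZ; apply: HV => //; exists i.
have [//|[a a1 Ha]] := irreducible_bounded_or_growing d0 irrB.
have : a * r <= r.
  apply: rho_d_ge => [|n]; first by rewrite mulr_ge0 ?ltW// (lt_trans _ a1).
  have [w nw Hw] := Ha n; exists w => //.
  move: Hw; rewrite word_prod_scale (opnormZ nrm_norm) ger0_norm ?exprn_ge0 ?invr_ge0 ?(ltW r0)//.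
  by rewrite exprVn ler_pdivlMl ?exprn_gt0// exprMn mulrC.
by rewrite -[leRHS]mul1r ler_pM2r// leNgt a1.
Qed.

End JointSpectralRadius.

(** * Expectations along stationary paths *)

Section ExtremalNorm.
Variables (R : realType) (d N : nat) (nrm : 'cV[R]_d -> R).
Hypothesis nrm_norm : is_norm nrm.

(** [v x] is the supremum of [nrm] over the orbit of [x]. The empty word gives [nrm <= v], and the
    orbit of [B_i x] is contained in that of [x]. *)
Lemma extremal_norm (B : 'I_N -> 'M[R]_d) (C : R) :
  (forall w, `|word_prod B w| <= C) ->
  exists2 v : 'cV[R]_d -> R, is_norm v & forall i, opnorm v (B i) <= 1.
Proof.
move=> HC; have [K K0 HK] := is_norm_upper nrm_norm.
have [n0 n1 nZ nD] := nrm_norm.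
pose O x := [set nrm (word_prod B w *m x) | w in [set: seq 'I_N]].
have Oub x : has_ubound (O x).
  exists (K * (d%:R * C * `|x|)) => _ [w _ <-].
  apply: le_trans (HK _) _; rewrite ler_pM2l// (le_trans (mx_norm_mulmx _ _))//.
  by rewrite ler_wpM2r// ler_wpM2l.
have Ox0 x : O x !=set0 by exists (nrm (word_prod B [::] *m x)), [::].
pose v x := sup (O x).
have vub w x : nrm (word_prod B w *m x) <= v x by apply: ub_le_sup => //; exists w.
have vle b x : (forall w, nrm (word_prod B w *m x) <= b) -> v x <= b.
  by move=> H; apply: ge_sup => // _ [w _ <-].
have nv x : nrm x <= v x by have := vub [::] x; rewrite mul1mx.
have v0 x : 0 <= v x by exact: le_trans (nv x).
have vZ (a : R) x : v (a *: x) <= `|a| * v x.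
  by apply: vle => w; rewrite -scalemxAr nZ ler_wpM2l.
have vnorm : is_norm v.
  split=> //.
  - by move=> x vx; apply: n1; apply/eqP; rewrite eq_le n0 andbT -vx.
  - move=> a x; apply/eqP; rewrite eq_le vZ /=.
    have [->|a0] := eqVneq a 0; first by rewrite normr0 mul0r.
    have := vZ a^-1 (a *: x); rewrite scalerA mulVf// scale1r normfV.
    by rewrite mulrC ler_pdivlMr ?normr_gt0// mulrC.
  - move=> x y; apply: vle => w; rewrite mulmxDr (le_trans (nD _ _))//.
    by rewrite lerD.
exists v => // i; apply: opnorm_le => // x; rewrite mul1r; apply: vle => w.
by rewrite mulmxA -word_prod_cons.
Qed.

End ExtremalNorm.

Section Expectation.
Variables (R : realType) (N : nat) (nu : 'rV[R]_N) (P : 'M[R]_N).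
Hypotheses (P_stoch : stochastic P) (nu_inv : invariant_probability P nu).
Implicit Types (F G : seq 'I_N -> R) (w : seq 'I_N).

(** The probability that the stationary Markov chain starts with the word [w]. *)
Definition weight w : R :=
  if w is i :: w' then nu ord0 i * path_weight P i w' else 1.

Definition expect n F : R := \sum_(w : n.-tuple 'I_N) weight w * F w.

Lemma weight_ge0 w : 0 <= weight w.
Proof.
case: w => //= i w; have [nu0 _ _] := nu_inv.
by rewrite mulr_ge0 ?path_weight_ge0//; case: P_stoch.
Qed.

Lemma sum_tuple0 F : \sum_(w : 0.-tuple 'I_N) F w = F [::].
Proof.
by rewrite (bigD1 [tuple])//= big1 ?addr0// => w /eqP[]; exact: tuple0.
Qed.

Lemma sum_tuple_cons n F :
  \sum_(w : n.+1.-tuple 'I_N) F w = \sum_i \sum_(w : n.-tuple 'I_N) F (i :: w).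
Proof.
rewrite pair_big /=.
rewrite (reindex (fun p : 'I_N * n.-tuple 'I_N => [tuple of p.1 :: p.2])) //=.
exists (fun w : n.+1.-tuple 'I_N => (thead w, [tuple of behead w])) => [[i w] _|w _].
  by congr pair; apply: val_inj.
by rewrite [RHS]tuple_eta.
Qed.

Lemma sum_tuple_rcons n F :
  \sum_(w : n.+1.-tuple 'I_N) F w = \sum_(w : n.-tuple 'I_N) \sum_i F (rcons w i).
Proof.
elim: n F => [|n IH] F.
  rewrite sum_tuple_cons (sum_tuple0 (fun w => \sum_i F (rcons w i))).
  by apply: eq_bigr => i _; exact: (sum_tuple0 (fun w => F (i :: w))).
rewrite sum_tuple_cons [RHS](sum_tuple_cons _ (fun w => \sum_i F (rcons w i))).
by apply: eq_bigr => i _; exact: (IH (fun w => F (i :: w))).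
Qed.

(** Stationarity: summing over the first letter uses [nu = nu P]. *)
Lemma expect_behead n F : expect n.+1 (F \o behead) = expect n F.
Proof.
rewrite /expect (sum_tuple_cons _ (fun w => weight w * (F \o behead) w)) exchange_big /=.
apply: eq_bigr => w _; rewrite -mulr_suml; congr (_ * _).
have [_ nu1 nuP] := nu_inv.
case: (tval w) => [|j u] /=; first by under eq_bigr do rewrite mulr1.
under eq_bigr do rewrite mulrA.
rewrite -mulr_suml; congr (_ * _).
by rewrite [in RHS]nuP mxE.
Qed.

(** Consistency: summing over the last letter uses that the rows of [P] have sum 1. *)
Lemma expect_take n F : expect n.+1 (F \o take n) = expect n F.
Proof.
rewrite /expect (sum_tuple_rcons _ (fun w => weight w * (F \o take n) w)).
apply: eq_bigr => w _.
under eq_bigr => i _ do rewrite /= -cats1 take_size_cat ?size_tuple//.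
rewrite -mulr_suml; congr (_ * _).
have [_ nu1 _] := nu_inv; have [_ P1] := P_stoch.
case: (tval w) => [|j u] /=; first by under eq_bigr do rewrite mulr1.
rewrite -mulr_sumr; congr (_ * _).
under eq_bigr => i _ do rewrite path_weight_cat /= mulr1.
by rewrite -mulr_sumr P1 mulr1.
Qed.

Lemma eq_expect n F G : (forall w, size w = n -> F w = G w) -> expect n F = expect n G.
Proof. by move=> FG; apply: eq_bigr => w _; rewrite FG ?size_tuple. Qed.

Lemma expect_drop k n F : expect (k + n) (F \o drop k) = expect n F.
Proof.
elim: k F => [|k IH] F; first by apply: eq_expect => w _; rewrite /= drop0.
rewrite addSn -IH -(expect_behead _ (F \o drop k)).
apply: (@eq_expect _ (F \o drop k.+1) ((F \o drop k) \o behead)) => w _.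
by rewrite /= -drop1 drop_drop addn1.
Qed.

Lemma expect_take_add k n F : expect (n + k) (F \o take n) = expect n F.
Proof.
elim: k F => [|k IH] F.
  by rewrite addn0; apply: eq_expect => w sw; rewrite /= take_oversize ?sw.
rewrite -IH addnS -(expect_take (n + k) (F \o take n)).
by apply: eq_expect => w _; rewrite /= take_takel ?leq_addr.
Qed.

(** The law of [m] consecutive letters does not depend on their position. *)
Lemma expect_block k m l F :
  expect (k + (m + l)) (fun w => F (take m (drop k w))) = expect m F.
Proof.
rewrite -(expect_take_add l m F); exact: (expect_drop k (m + l) (F \o take m)).
Qed.

Lemma expect_cst n (c : R) : expect n (fun=> c) = c.
Proof.
have := expect_take_add n 0 (fun=> c); rewrite add0n => E.
rewrite -[LHS]/(expect n ((fun=> c) \o take 0)) E /expect.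
by rewrite (sum_tuple0 (fun w => weight w * c)) mul1r.
Qed.

Lemma expect_le n F G : (forall w, size w = n -> F w <= G w) -> expect n F <= expect n G.
Proof.
by move=> FG; apply: ler_sum => w _; rewrite ler_wpM2l ?weight_ge0 ?FG ?size_tuple.
Qed.

Lemma expectM n (c : R) F : expect n (fun w => c * F w) = c * expect n F.
Proof. by rewrite mulr_sumr; apply: eq_bigr => w _; rewrite mulrCA. Qed.

Lemma expectD n F G : expect n (fun w => F w + G w) = expect n F + expect n G.
Proof. by rewrite -big_split; apply: eq_bigr => w _; rewrite mulrDr. Qed.

Lemma expect_sum n q (F : 'I_q -> seq 'I_N -> R) :
  expect n (fun w => \sum_i F i w) = \sum_i expect n (F i).
Proof. by rewrite exchange_big; apply: eq_bigr => w _; rewrite mulr_sumr. Qed.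

Lemma expect_ge1 n F : (forall w, F w <= 1) -> 1 <= expect n F ->
  forall w, size w = n -> 0 < weight w -> 1 <= F w.
Proof.
move=> F1 EF w /eqP sw ww.
have : \sum_(u : n.-tuple 'I_N) weight u * (1 - F u) <= 0.
  rewrite (_ : \sum_(u : _) _ = expect n (fun=> 1) - expect n F).
    by rewrite expect_cst subr_le0.
  by rewrite -sumrB; apply: eq_bigr => u _; rewrite mulrBr.
rewrite (bigD1 (Tuple sw))//= => H.
have : weight w * (1 - F w) <= 0.
  apply: le_trans H; rewrite lerDl; apply: sumr_ge0 => u _.
  by rewrite mulr_ge0 ?weight_ge0// subr_ge0.
by rewrite pmulr_rle0// subr_le0.
Qed.

End Expectation.

Section Subadditive.
Variables (R : realType) (N : nat) (nu : 'rV[R]_N) (P : 'M[R]_N).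
Hypotheses (P_stoch : stochastic P) (nu_inv : invariant_probability P nu).
Variable g : seq 'I_N -> R.
Hypotheses (g_ge0 : forall w, 0 <= g w) (g_le1 : forall w, g w <= 1).
Hypothesis g_cat : forall u w, g (u ++ w) <= g u * g w.

(** The letters left over after the [q] blocks contribute a factor at most 1. *)
Lemma submul_blocks m q w : g w <= \prod_(j < q) g (take m (drop (j * m) w)).
Proof.
elim: q w => [|q IH] w; first by rewrite big_ord0.
rewrite big_ord_recl /= mul0n drop0 -{1}(cat_take_drop m w).
apply: le_trans (g_cat _ _) _; rewrite ler_wpM2l//.
apply: le_trans (IH _) _; rewrite le_eqVlt; apply/orP; left; apply/eqP.
by apply: eq_bigr => j _; rewrite drop_drop mulSn addnC.
Qed.

(* AM-GM over the [q] blocks of length [m] of [w] and one dummy value [1]. *)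
Lemma root_le_block_mean m n q w : q = (n.+1 %/ m.+1)%N ->
  g w `^ n.+1%:R^-1 <=
  (\sum_(j < q) g (take m.+1 (drop (j * m.+1) w)) `^ m.+1%:R^-1 + 1) / q.+1%:R.
Proof.
move=> qE; set h := g w `^ _.
pose s (j : 'I_q) := g (take m.+1 (drop (j * m.+1) w)) `^ m.+1%:R^-1.
have s0 j : 0 <= s j by exact: powR_ge0.
have h0 : 0 <= h by exact: powR_ge0.
have h1 : h <= 1 by apply: powR_invn_le => //; rewrite expr1n.
(* Rounding the number of blocks up to [q + 1] makes the exponent at least [n + 1]; since [h <= 1],
   the power of [h] stays below [g w]. *)
have nq : (n.+1 <= q.+1 * m.+1)%N.
  by rewrite qE ltnW// ltn_ceil.
have hprod : h ^+ q.+1 <= \prod_j s j.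
  rewrite -(@ler_pXn2r _ m.+1)// ?nnegrE ?exprn_ge0 ?prodr_ge0//.
  rewrite -exprM -prodrXl; apply: le_trans (ler_wiXn2l h0 h1 nq) _.
  rewrite powR_invnXK//; apply: le_trans (submul_blocks m.+1 q w) _.
  rewrite le_eqVlt; apply/orP; left; apply/eqP; apply: eq_bigr => j _.
  by rewrite powR_invnXK.
(* The dummy value 1 leaves the product unchanged and makes the number of factors equal to the
   exponent [q + 1]. *)
pose t (j : 'I_q.+1) := if unlift ord_max j is Some j' then s j' else 1.
have t0 j : 0 <= t j by rewrite /t; case: unliftP.
have tprod : \prod_j t j = \prod_j s j.
  rewrite big_ord_recr /= {2}/t unlift_none mulr1; apply: eq_bigr => j _.
  have -> : widen_ord (leqnSn q) j = lift ord_max j.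
    by apply: val_inj; rewrite /= /bump leqNgt ltn_ord.
  by rewrite /t liftK.
have tsum : \sum_j t j = \sum_j s j + 1.
  rewrite big_ord_recr /= {2}/t unlift_none; congr (_ + _); apply: eq_bigr => j _.
  have -> : widen_ord (leqnSn q) j = lift ord_max j.
    by apply: val_inj; rewrite /= /bump leqNgt ltn_ord.
  by rewrite /t liftK.
have agm : \prod_j t j <= ((\sum_j t j) / q.+1%:R) ^+ q.+1.
  have := (@leif_AGM R _ predT t (fun j _ => t0 j)).1.
  by rewrite cardT size_enum_ord.
have : h ^+ q.+1 <= ((\sum_j s j + 1) / q.+1%:R) ^+ q.+1.
  by apply: le_trans hprod _; rewrite -tprod -tsum.
by rewrite ler_pXn2r// nnegrE divr_ge0// addr_ge0// sumr_ge0.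
Qed.

Lemma expect_root_le m n q : q = (n.+1 %/ m.+1)%N ->
  expect nu P n.+1 (fun w => g w `^ n.+1%:R^-1) <=
  (q%:R * expect nu P m.+1 (fun w => g w `^ m.+1%:R^-1) + 1) / q.+1%:R.
Proof.
move=> qE.
apply: le_trans (expect_le P_stoch nu_inv (fun w _ => root_le_block_mean w qE)) _.
under eq_expect => w _ do rewrite mulrC.
rewrite expectM mulrC ler_pM2r ?invr_gt0// expectD (expect_cst P_stoch nu_inv) lerD2r.
rewrite expect_sum (eq_bigr (fun=> expect nu P m.+1 (fun w => g w `^ m.+1%:R^-1))).
  by rewrite sumr_const card_ord mulr_natl.
move=> j _.
have jn : (j * m.+1 + m.+1 <= n.+1)%N.
  by rewrite addnC -mulSn (leq_trans _ (leq_divM n.+1 m.+1))// -qE leq_mul2r ltn_ord orbT.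
rewrite -[in LHS](subnKC jn) -addnA.
exact: (expect_block P_stoch nu_inv _ _ _ (fun w => g w `^ m.+1%:R^-1)).
Qed.

End Subadditive.

(** * The probabilistic radius *)

Section InvariantProbability.
Variables (R : realType) (N : nat) (P : 'M[R]_N).
Hypothesis P_stoch : stochastic P.

Let P_ge0 i j : 0 <= P i j. Proof. by case: P_stoch. Qed.

(** [1 - P] kills the column of ones, so it has a nonzero left null vector [v]. Entrywise
    [|v| <= |v| P], and both sides have the same sum, so they agree; it remains to normalize
    [|v|]. *)
Lemma invariant_probability_exists : (0 < N)%N -> exists nu, invariant_probability P nu.
Proof.
move=> N0; have [_ P1] := P_stoch.
have P1c : (1%:M - P) *m (const_mx 1 : 'cV[R]_N) = 0.
  apply/matrixP => i j; rewrite mulmxBl mul1mx !mxE.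
  by under eq_bigr do rewrite mxE mulr1; rewrite P1 subrr.
have /det0P[v v0] : \det (1%:M - P) == 0.
  apply/negPn/negP => det0.
  have u : 1%:M - P \in unitmx by rewrite unitmxE unitfE.
  have := mulKmx u (const_mx 1 : 'cV[R]_N).
  rewrite P1c mulmx0 => /matrixP/(_ (Ordinal N0) 0); rewrite !mxE => /esym/eqP.
  by rewrite oner_eq0.
rewrite mulmxBr mulmx1 => /eqP; rewrite subr_eq0 => /eqP vP.
pose a i := `|v 0 i|.
have aP j : a j <= \sum_i a i * P i j.
  rewrite /a {1}vP mxE (le_trans (ler_norm_sum _ _ _))// le_eqVlt.
  by apply/orP; left; apply/eqP/eq_bigr => i _; rewrite normrM (ger0_norm (P_ge0 _ _)).
have sumP : \sum_j \sum_i a i * P i j = \sum_i a i.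
  by rewrite exchange_big; apply: eq_bigr => i _; rewrite -mulr_sumr P1 mulr1.
have aE j : a j = \sum_i a i * P i j.
  apply/eqP; rewrite eq_sym -subr_eq0; apply/eqP.
  have sum0 : \sum_j (\sum_i a i * P i j - a j) = 0 by rewrite sumrB sumP subrr.
  have ge0 k : true -> 0 <= \sum_i a i * P i k - a k by rewrite subr_ge0.
  exact: (psumr_eq0P ge0 sum0).
set S := \sum_i a i.
have S0 : 0 < S.
  rewrite lt_neqAle sumr_ge0 ?andbT => [|i _]; last exact: normr_ge0.
  rewrite eq_sym; apply: contra v0; rewrite psumr_eq0 => [/allP H|i _]; last exact: normr_ge0.
  apply/eqP/matrixP => i j; rewrite ord1 mxE; apply/eqP; rewrite -normr_eq0.
  by apply: H; rewrite mem_index_enum.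
exists (\row_i (a i / S)); split.
- by move=> i; rewrite mxE divr_ge0 ?normr_ge0// ltW.
- under eq_bigr do rewrite mxE.
  by rewrite -mulr_suml divff// gt_eqF.
- apply/matrixP => i j; rewrite !mxE {1}aE mulr_suml.
  by apply: eq_bigr => k _; rewrite mxE mulrAC.
Qed.

(** Positivity propagates along the edges. The vector is not normalized, so that the lemma also
    covers the difference [nu - t mu] in the uniqueness proof. *)
Lemma invariant_gt0 (mu : 'rV[R]_N) j : strongly_connected P ->
  (forall i, 0 <= mu ord0 i) -> mu = mu *m P -> 0 < mu ord0 j ->
  forall i, 0 < mu ord0 i.
Proof.
move=> Pc mu0 muP muj i.
have /connectP[p] := strongly_connected_connect P_ge0 Pc j i.
elim: p j muj => [|k p IH] j muj /=; first by move=> _ ->.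
move=> /andP[jk pk] il; apply: IH pk il.
rewrite muP mxE (bigD1 j)//= ltr_pwDl ?mulr_gt0//.
by apply: sumr_ge0 => l _; rewrite mulr_ge0.
Qed.

Lemma invariant_probability_gt0 nu : strongly_connected P ->
  invariant_probability P nu -> forall i, 0 < nu ord0 i.
Proof.
move=> Pc [nu0 nu1 nuP].
have [j nuj] : exists j, 0 < nu ord0 j.
  apply: contrapT => H; have : \sum_i nu ord0 i = 0.
    apply: big1 => i _; apply/eqP; rewrite eq_le nu0 andbT leNgt.
    by apply/negP => ?; apply: H; exists i.
  by rewrite nu1 => /eqP; rewrite oner_eq0.
exact: invariant_gt0 nuj.
Qed.

(* Subtract from [nu] the largest multiple of [mu] that it dominates. *)
Lemma invariant_probability_unique nu mu : (0 < N)%N -> strongly_connected P ->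
  invariant_probability P nu -> invariant_probability P mu -> nu = mu.
Proof.
move=> N0 Pc inu imu.
have mu_gt0 := invariant_probability_gt0 Pc imu.
have [nu0 nu1 nuP] := inu; have [mu0 mu1 muP] := imu.
pose F i := nu ord0 i / mu ord0 i.
have [i0 _ minF] : extremum_spec <=%O xpredT F [arg min_(i < Ordinal N0) F i]%O.
  exact: arg_minP.
set t := F i0 in minF; pose w := nu - t *: mu.
have w0 i : 0 <= w ord0 i.
  by rewrite !mxE subr_ge0 -ler_pdivlMr//; exact: minF.
have wP : w = w *m P by rewrite mulmxBl -scalemxAl -nuP -muP.
have wi0 : w ord0 i0 = 0 by rewrite !mxE /t /F divfK ?gt_eqF// subrr.
have w_eq0 : w = 0.
  apply/matrixP => i j; rewrite ord1 [RHS]mxE; apply/eqP; rewrite eq_le w0 andbT leNgt.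
  by apply/negP => wj; have := invariant_gt0 Pc w0 wP wj i0; rewrite wi0 ltxx.
have nut : nu = t *: mu by apply/eqP; rewrite -subr_eq0; apply/eqP.
have t1 : t = 1.
  move: nu1; rewrite nut; under eq_bigr do rewrite mxE.
  by rewrite -mulr_sumr mu1 mulr1.
by rewrite nut t1 scale1r.
Qed.

Lemma rho_pE d (nrm : 'cV[R]_d -> R) A nu : (0 < N)%N -> strongly_connected P ->
  invariant_probability P nu -> rho_p nrm P A = rho_p_nu nrm nu P A.
Proof.
move=> N0 Pc inu; rewrite /rho_p.
rewrite (_ : [set _ | _ in _] = [set rho_p_nu nrm nu P A]) ?sup1//.
apply/seteqP; split => [_ [mu imu <-]|_ ->]; last by exists nu.
by rewrite (invariant_probability_unique N0 Pc imu inu).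
Qed.

End InvariantProbability.

Section ProbabilisticRadius.
Variables (R : realType) (d N : nat) (nrm : 'cV[R]_d -> R).
Variables (nu : 'rV[R]_N) (P : 'M[R]_N) (A : 'I_N -> 'M[R]_d).
Hypotheses (nrm_norm : is_norm nrm) (P_stoch : stochastic P).
Hypothesis nu_inv : invariant_probability P nu.
Let term n := expect nu P n.+1 (fun w => opnorm nrm (word_prod A w) `^ n.+1%:R^-1).

Lemma rho_p_nuE : rho_p_nu nrm nu P A = limn_sup term.
Proof.
congr limn_sup; apply/funext => n; rewrite /term /expect; apply: eq_bigr => w _.
by case/tupleP: w => i w; rewrite theadE.
Qed.

Lemma term_bounded : exists c : R, forall n, `|term n| <= c.
Proof.
have [m m0 Am] := opnorm_letters_ub nrm_norm A; exists m => n.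
have w0 := weight_ge0 P_stoch nu_inv.
rewrite ger0_norm; last by apply: sumr_ge0 => w _; rewrite mulr_ge0 ?powR_ge0.
rewrite -[leRHS](expect_cst P_stoch nu_inv n.+1 m).
apply: (expect_le P_stoch nu_inv) => w sw.
by apply: powR_invn_le => //; rewrite ?opnorm_ge0// -[in leRHS]sw; exact: opnorm_word_le.
Qed.

End ProbabilisticRadius.

Section Comparison.
Variables (R : realType) (d N : nat) (nrm : 'cV[R]_d -> R).
Variables (nu : 'rV[R]_N) (P : 'M[R]_N) (A : 'I_N -> 'M[R]_d) (r : R).
Hypotheses (nrm_norm : is_norm nrm) (P_stoch : stochastic P).
Hypotheses (nu_inv : invariant_probability P nu) (r_gt0 : 0 < r).
Let B i := r^-1 *: A i.

Lemma opnorm_unscale w :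
  opnorm nrm (word_prod A w) = r ^+ size w * opnorm nrm (word_prod B w).
Proof.
rewrite word_prod_scale (opnormZ nrm_norm) ger0_norm ?exprn_ge0 ?invr_ge0 ?(ltW r_gt0)//.
by rewrite exprVn mulVKf// expf_neq0// gt_eqF.
Qed.

Lemma root_unscale n w : size w = n.+1 ->
  opnorm nrm (word_prod A w) `^ n.+1%:R^-1 =
  r * opnorm nrm (word_prod B w) `^ n.+1%:R^-1.
Proof.
move=> sw; rewrite opnorm_unscale sw powRM ?exprn_ge0 ?opnorm_ge0 ?(ltW r_gt0)//.
by rewrite powR_invnK// ltW.
Qed.

(** The block estimate bounds the terms by [r * b n], where [b] tends to [a < 1]: the constant [K]
    comparing the two operator norms disappears under the root, and the dummy block costs at most
    [(m + 1) / (n + 1)]. *)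
Lemma rho_p_nu_lt (v : 'cV[R]_d -> R) m : is_norm v ->
  (forall i, opnorm v (B i) <= 1) ->
  expect nu P m.+1 (fun w => opnorm v (word_prod B w) `^ m.+1%:R^-1) < 1 ->
  rho_p_nu nrm nu P A < r.
Proof.
move=> v_norm Bv1; pose g w := opnorm v (word_prod B w).
have g0 w : 0 <= g w by exact: opnorm_ge0.
have g1 w : g w <= 1 by have := opnorm_word_le v_norm w Bv1; rewrite expr1n.
have gM u w : g (u ++ w) <= g u * g w.
  by rewrite /g word_prod_cat mulrC; exact: opnorm_mul.
set a := expect _ _ _ _ => a1.
have a0 : 0 <= a.
  apply: sumr_ge0 => w _; rewrite mulr_ge0 ?powR_ge0//; exact: weight_ge0.
have [K1 K10 HK1] := opnorm_le_mx_norm nrm_norm.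
have [K2 K20 HK2] := mx_norm_le_opnorm v_norm.
have nv M : opnorm nrm M <= K1 * K2 * opnorm v M.
  by apply: le_trans (HK1 _) _; rewrite -mulrA ler_pM2l.
set K := K1 * K2 in nv; have K0 : 0 < K by rewrite mulr_gt0.
pose b n : R := K `^ n.+1%:R^-1 * (a + m.+1%:R * n.+1%:R^-1).
have termb n :
    expect nu P n.+1 (fun w => opnorm nrm (word_prod A w) `^ n.+1%:R^-1) <= r * b n.
  pose q := (n.+1 %/ m.+1)%N.
  apply: (@le_trans _ _ (expect nu P n.+1
      (fun w => r * K `^ n.+1%:R^-1 * g w `^ n.+1%:R^-1))).
    apply: (expect_le P_stoch nu_inv) => w sw.
    rewrite (root_unscale sw) -mulrA ler_pM2l// -powRM ?(ltW K0)//.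
    apply: ge0_ler_powR; last exact: nv; rewrite ?nnegrE ?invr_ge0 ?opnorm_ge0//.
    exact: mulr_ge0 (ltW K0) (g0 w).
  rewrite expectM /b mulrA ler_wpM2l ?mulr_ge0 ?powR_ge0 ?(ltW r_gt0)//.
  apply: le_trans (expect_root_le P_stoch nu_inv g0 g1 gM (erefl q)) _.
  rewrite -/a ler_pdivrMr ?ltr0n//.
  have hq : 1 <= m.+1%:R / n.+1%:R * q.+1%:R :> R.
    rewrite mulrAC ler_pdivlMr ?ltr0n// mul1r -natrM ler_nat mulnC.
    by rewrite ltnW// ltn_ceil.
  rewrite mulrDl -natr1; apply: lerD; last by rewrite natr1.
  by rewrite mulrDr mulr1 mulrC lerDl.
have cb : b @ \oo --> a.
  suff : b @ \oo --> 1 * (a + m.+1%:R * 0) by rewrite mulr0 addr0 mul1r.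
  apply: cvgM; first exact: cvg_powR_invn.
  apply: cvgD; first exact: cvg_cst.
  by apply: cvgM; [exact: cvg_cst|exact: cvg_harmonic].
(* The midpoint of [a] and 1 is eventually above [b n] and still below 1. *)
rewrite rho_p_nuE//; apply: (@le_lt_trans _ _ (r * ((1 + a) / 2))); last first.
  rewrite -[ltRHS]mulr1 ltr_pM2l//; lra.
have [c Hc] := term_bounded A nrm_norm P_stoch nu_inv.
apply: (limn_sup_le Hc).
have lt : a < (1 + a) / 2 by lra.
near=> n; apply: le_trans (termb n) _; rewrite ler_pM2l//.
near: n; exact: cvgr_le cb _ lt.
Unshelve. all: by end_near. Qed.

(** Each term lies between [r] times the root of [c] and [r] times the root of [C], and both bounds
    tend to [r]. *)
Lemma rho_p_nu_eq (c C : R) : 0 < c ->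
  (forall w, c <= opnorm nrm (word_prod B w) <= C) -> rho_p_nu nrm nu P A = r.
Proof.
move=> c0 H; rewrite rho_p_nuE.
have C0 : 0 < C by have /andP[h1 h2] := H [::]; exact: lt_le_trans c0 (le_trans h1 h2).
have lim (x : R) : 0 < x -> (fun n => r * x `^ n.+1%:R^-1) @ \oo --> r.
  move=> x0; rewrite -[X in _ --> X]mulr1.
  by apply: cvgM; [exact: cvg_cst|exact: cvg_powR_invn].
apply: (cvg_limn_inf_sup _).2.
apply: squeeze_cvgr (lim _ c0) (lim _ C0).
apply: nearW => n; apply/andP; split.
  rewrite -[leLHS](expect_cst P_stoch nu_inv n.+1).
  apply: (expect_le P_stoch nu_inv) => w sw; rewrite (root_unscale sw) ler_pM2l//.
  have /andP[h _] := H w.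
  by rewrite ge0_ler_powR ?nnegrE ?invr_ge0 ?opnorm_ge0 ?(ltW c0).
rewrite -[leRHS](expect_cst P_stoch nu_inv n.+1).
apply: (expect_le P_stoch nu_inv) => w sw; rewrite (root_unscale sw) ler_pM2l//.
have /andP[_ h] := H w.
by rewrite ge0_ler_powR ?nnegrE ?invr_ge0 ?opnorm_ge0 ?(ltW C0).
Qed.

End Comparison.

(** * Orthogonality and the equality of the radii *)

Section Equality.
Variables (R : realType) (d N : nat).
Implicit Types (P : 'M[R]_N) (B : 'I_N -> 'M[R]_d).

(** Cycles with the same starting index concatenate; the empty product is the case of the
    identity. *)
Lemma gen_cycle_products B P s (S : set 'M[R]_d) M : S `<=` cycle_products B P s ->
  gen S M -> M = 1%:M \/ cycle_products B P s M.
Proof.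
move=> SC; elim=> [|X M' /SC[w wP <-] _ [->|[w' wP' <-]]]; first by left.
  by right; exists w => //; rewrite mulmx1.
right; exists (w' ++ s :: w); last by rewrite -cat_cons word_prod_cat.
move: wP wP'; rewrite /= /P_cycle => wP wP'.
rewrite rcons_cat rcons_cons -cat_rcons path_weight_cat last_rcons.
exact: mulr_gt0.
Qed.

Lemma isometry_mxgroup (Q : 'M[R]_d) :
  is_mxgroup [set M | M \in unitmx /\ pullback M Q = Q].
Proof.
split=> [|M L [Mu MQ] [Lu LQ]|M [Mu MQ]] /=.
- by split; [exact: unitmx1|rewrite /pullback trmx1 mul1mx mulmx1].
- by split; [rewrite unitmx_mul Mu|rewrite pullback_mul MQ].
- split; first by rewrite unitmx_inv.
  by rewrite -[in LHS]MQ -pullback_mul mulmxV// /pullback trmx1 mul1mx mulmx1.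
Qed.

Lemma orthogonal_of_pullback (G M : 'M[R]_d) : G \in unitmx ->
  pullback M (G^T *m G) = G^T *m G -> orthogonal_mx (G *m M *m invmx G).
Proof.
move=> Gu; rewrite /pullback /orthogonal_mx => E.
rewrite !trmx_mul; set Gi := invmx G.
rewrite (_ : _ *m _ = Gi^T *m (M^T *m (G^T *m G) *m M) *m Gi); last first.
  by rewrite !mulmxA.
by rewrite E !mulmxA -trmx_mul mulmxV// trmx1 mul1mx mulmxV.
Qed.

Lemma orthogonal_norm_le1 (M : 'M[R]_d) : orthogonal_mx M -> `|M| <= 1.
Proof.
move=> MO; apply: mx_norm_le => // i j.
have := congr1 (fun L : 'M[R]_d => L j j) MO; rewrite !mxE eqxx => e.
have : M i j ^+ 2 <= 1.
  rewrite -[leRHS]e (bigD1 i)//= mxE -expr2 lerDl.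
  by apply: sumr_ge0 => k _; rewrite mxE -expr2 sqr_ge0.
by rewrite -[leRHS](expr1n _ 2) -ler_sqrt ?sqr_ge0// !sqrtr_sqr normr1.
Qed.

Lemma orthogonal_mx_mul (M L : 'M[R]_d) : orthogonal_mx M -> orthogonal_mx L ->
  orthogonal_mx (M *m L).
Proof.
rewrite /orthogonal_mx => MO LO.
by rewrite trmx_mul mulmxA -(mulmxA L^T) MO mulmx1.
Qed.

(** Every product is [G^-1 W G] with [W] orthogonal, which gives the upper bound [C]. Its inverse
    [G^-1 W^T G] obeys the same bound, whence the lower bound [1 / C]. *)
Lemma orthogonal_conj_bounds (nrm : 'cV[R]_d -> R) B (G : 'M[R]_d) :
  (0 < d)%N -> is_norm nrm -> G \in unitmx ->
  (forall i, orthogonal_mx (G *m B i *m invmx G)) ->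
  exists c C : R, 0 < c /\ forall w, c <= opnorm nrm (word_prod B w) <= C.
Proof.
move=> d0 nrm_norm Gu BO.
have conjw w : exists2 W, orthogonal_mx W & word_prod B w = invmx G *m W *m G.
  elim: w => [|i w [W WO wE]].
    exists 1%:M; first by rewrite /orthogonal_mx trmx1 mul1mx.
    by rewrite mulmx1 mulVmx.
  exists (W *m (G *m B i *m invmx G)); first exact: orthogonal_mx_mul.
  by rewrite word_prod_cons wE !mulmxA mulmxKV.
have [K K0 HK] := opnorm_le_mx_norm nrm_norm.
pose C := K * (d%:R * (d%:R * `|invmx G|) * `|G|).
have ub W : `|W| <= 1 -> opnorm nrm (invmx G *m W *m G) <= C.
  move=> W1; apply: le_trans (HK _) _; rewrite ler_pM2l//.
  rewrite (le_trans (mx_norm_mulmx _ _))// ler_wpM2r// ler_wpM2l//.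
  by rewrite (le_trans (mx_norm_mulmx _ _))// ler_piMr// mulr_ge0.
have C1 : 1 <= C.
  apply: le_trans (opnorm1_gt0 nrm_norm d0) _.
  rewrite -(mulVmx Gu) -[X in X *m G]mulmx1; apply: ub.
  by apply: orthogonal_norm_le1; rewrite /orthogonal_mx trmx1 mul1mx.
have C0 : 0 < C by exact: lt_le_trans C1.
exists C^-1, C; split=> [|w]; first by rewrite invr_gt0.
have [W WO ->] := conjw w; rewrite ub ?orthogonal_norm_le1// andbT.
rewrite -[leLHS]mul1r ler_pdivrMr//; apply: le_trans (opnorm1_gt0 nrm_norm d0) _.
have -> : 1%:M = (invmx G *m W *m G) *m (invmx G *m W^T *m G).
  by rewrite !mulmxA mulmxK// -(mulmxA _ W) (mulmx1C WO) mulmx1 mulVmx.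
apply: le_trans (opnorm_mul nrm_norm _ _) _; rewrite ler_wpM2l ?opnorm_ge0//.
by apply: ub; rewrite mx_norm_trmx; exact: orthogonal_norm_le1.
Qed.

End Equality.

Theorem proposition3p9 (R : realType) (d N : nat) (d_gt0 : (0 < d)%N)
    (N_gt0 : (0 < N)%N) (nrm : 'cV[R]_d -> R) (nrm_norm : is_norm nrm)
    (P : 'M[R]_N) (P_stoch : stochastic P) (P_conn : strongly_connected P)
    (P_diag : forall i, 0 < P i i)
    (A : 'I_N -> 'M[R]_d) (A_irr : irreducible_mxset (range A))
    (A_unit : forall i, A i \in unitmx) :
  (forall s : 'I_N, irreducible_mxset (cycle_products A P s)) /\
  (rho_d nrm A = rho_p nrm P A <->
   exists G : 'M[R]_d, G \in unitmx /\
     forall i, orthogonal_mx ((rho_d nrm A)^-1 *: (G *m A i *m invmx G))).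
Proof.
have P_ge0 i j : 0 <= P i j by case: P_stoch.
split=> [s|].
  have [L [LC HL]] := cycle_generators s A_unit P_ge0 P_diag P_conn.
  apply: (irreducible_generators A_irr); first exact: cycle_products_unit.
  by move=> H gH SH; apply: HL => // M /LC /SH.
have [nu nuP] := invariant_probability_exists P_stoch N_gt0.
rewrite (rho_pE P_stoch nrm A N_gt0 P_conn nuP).
have r_gt0 : 0 < rho_d nrm A by exact: rho_d_gt0.
have [C HC] := scaled_products_bounded nrm_norm d_gt0 A_irr r_gt0.
set r := rho_d nrm A in r_gt0 HC *; pose B i := r^-1 *: A i.
have BE (G : 'M[R]_d) i : r^-1 *: (G *m A i *m invmx G) = G *m B i *m invmx G.
  by rewrite /B -scalemxAr -scalemxAl.
split=> [req|[G [Gu GO]]]; last first.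
  have GB i : orthogonal_mx (G *m B i *m invmx G) by rewrite -BE.
  have [c [C' [c0 Hc]]] := orthogonal_conj_bounds d_gt0 nrm_norm Gu GB.
  by rewrite (rho_p_nu_eq nrm_norm P_stoch nuP r_gt0 c0 Hc).
have [v v_norm Bv] := extremal_norm nrm_norm HC.
(* The expectation is taken at the length of [s :: w] itself. It cannot be below 1, as [rho_p_nu_lt]
   would contradict [req], so the integrand is 1 on each word of positive weight. *)
have v1 s w : 0 < path_weight P s w -> 1 <= opnorm v (word_prod B (s :: w)).
  move=> Pw; have wpos : 0 < weight nu P (s :: w).
    by rewrite /= mulr_gt0//; exact: (invariant_probability_gt0 P_stoch P_conn nuP).
  have Bv1 u : opnorm v (word_prod B u) <= 1.
    by have := opnorm_word_le v_norm u Bv; rewrite expr1n.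
  have le1 u : opnorm v (word_prod B u) `^ (size w).+1%:R^-1 <= 1.
    by apply: powR_invn_le; rewrite ?opnorm_ge0// expr1n.
  have ge1 : 1 <= expect nu P (size w).+1
      (fun u => opnorm v (word_prod B u) `^ (size w).+1%:R^-1).
    rewrite leNgt; apply/negP => lt1.
    by have := rho_p_nu_lt nrm_norm P_stoch nuP r_gt0 v_norm Bv lt1; rewrite -req ltxx.
  have := expect_ge1 P_stoch nuP le1 ge1 (erefl : size (s :: w) = _) wpos.
  rewrite -(ler_pXn2r (n := (size w).+1)) ?nnegrE ?powR_ge0// expr1n.
  by rewrite powR_invnXK ?opnorm_ge0.
have B_unit i : B i \in unitmx.
  by rewrite unitmxZ// unitfE invr_eq0 gt_eqF.
have B_irr : irreducible_mxset (range B).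
  move=> V HV; apply: A_irr => _ [i _ <-] x xV.
  have -> : A i = r *: B i by rewrite scalerA divff ?gt_eqF// scale1r.
  by rewrite -scalemxAl; apply: rpredZ; apply: HV => //; exists i.
pose s := Ordinal N_gt0.
have [L0 [L0C HL]] := cycle_generators s B_unit P_ge0 P_diag P_conn.
(* The cycle of length 1 at [s] is added to make the list nonempty. *)
pose L := B s :: L0.
have LC : [set` L] `<=` cycle_products B P s.
  move=> M; rewrite /= inE => /orP[/eqP ->|]; last exact: L0C.
  by exists [::]; [rewrite /= /P_cycle /= mulr1|exact: word_prod1].
have LH (H : set 'M[R]_d) : is_mxgroup H -> [set` L] `<=` H -> forall i, H (B i).
  by move=> gH SH; apply: HL => // M ML; apply: SH; rewrite /= inE ML orbT.
have LU : [set` L] `<=` [set M | M \in unitmx].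
  by apply: subset_trans LC _; exact: cycle_products_unit.
have L_irr : irreducible_mxset [set` L] by exact: irreducible_generators B_irr LU LH.
have [K K0 HK] := opnorm_le_mx_norm v_norm.
(* The weight of a cycle is that of its open path times that of its closing edge, so the open path
   has positive weight and [v1] applies. *)
have genB M : gen [set` L] M -> exists w, M = word_prod B w /\ 1 <= opnorm v M.
  move=> /(gen_cycle_products LC)[->|[w wP <-]].
    by exists [::]; split=> //; exact: opnorm1_gt0.
  exists (s :: w); split=> //; apply: v1; move: wP; rewrite /= /P_cycle.
  rewrite -cats1 path_weight_cat => h.
  by rewrite lt_neqAle path_weight_ge0// andbT; apply/eqP => e; rewrite -e mul0r ltxx in h.
(* The lower bound [K^-1] comes from [1 <= opnorm v M <= K |M|]. *)
have [||||||Q Qpd LQ] := @bounded_semigroup_form _ _ L C K^-1.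
- by [].
- exact: LU.
- exact: L_irr.
- by move=> M /genB[w [-> _]].
- by rewrite invr_gt0.
- move=> M /genB[w [_ M1]]; rewrite -[leLHS]mul1r ler_pdivrMr// mulrC.
  exact: le_trans M1 (HK M).
have [G Gu QG] := pos_def_factor Qpd.
exists G; split=> // i; rewrite BE; apply: orthogonal_of_pullback => //.
rewrite -QG; apply: (LH _ (isometry_mxgroup Q) _ i).2 => M ML.
by split; [exact: LU|exact: LQ].
Qed.
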